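(* Let $n\ge 1$, $d\ge 1$ and $1\le p\le\infty$, and let $x$ be a holomorphic polynomial in the free group von Neumann algebra $\widehat{\mathbb{F}}_n$. \begin{enumerate} \item If $x\in\mathcal{P}^{\ge d}$, then $\|P_t(x)\|_p\le e^{-td}\|x\|_p$ for all $t\ge 0$, and $\|L(x)\|_p\ge d\|x\|_p$. \item If $x\in\mathcal{P}^{\le d}$, then $\|L(x)\|_p\le d\|x\|_p$, and $\|P_t(x)\|_p\ge e^{-td}\|x\|_p$ for all $t\ge 0$. \end{enumerate}
   Context: $\mathbb{F}_n$ is the free group on generators $g_1,\dots,g_n$ with unit $e$, and $\lambda$ is its left regular representation on $\ell_2(\mathbb{F}_n)$, $\lambda_g f(h)=f(g^{-1}h)$. $\widehat{\mathbb{F}}_n$ is the von Neumann algebra generated by $\{\lambda_g: g\in\mathbb{F}_n\}$, with canonical faithful tracial state $\tau(x)=\langle x\delta_e,\delta_e\rangle$, so that $\tau(\sum_g x_g\lambda_g)=x_e$. For $1\le p<\infty$, $\|x\|_p=\tau((x^*x)^{p/2})^{1/p}$, and $\|\cdot\|_\infty$ is the operator norm; $L_p(\widehat{\mathbb{F}}_n)$ is the corresponding noncommutative $L_p$-space. A polynomial is a finite sum $\sum_g x_g\lambda_g$ with $x_g\in\mathbb{C}$. $|g|$ denotes the word length of $g$ with respect to $g_1^{\pm1},\dots,g_n^{\pm1}$. For $t\ge0$, $P_t(\sum_g x_g\lambda_g)=\sum_g e^{-t|g|}x_g\lambda_g$ (this is unital, completely positive and trace preserving, and extends to a contraction on every $L_p$),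 and $L(\sum_g x_g\lambda_g)=\sum_g |g|x_g\lambda_g$, so that $P_t=e^{-tL}$. $\mathcal{P}^{\le d}$ (resp. $\mathcal{P}^{\ge d}$) is the complex linear span of $\{\lambda_g:|g|\le d\}$ (resp. $\{\lambda_g:|g|\ge d\}$). $\mathbb{F}_n^+$ is the subsemigroup of $\mathbb{F}_n$ generated by $g_1,\dots,g_n$ (including $e$), and a polynomial is holomorphic if it has the form $\sum_{g\in\mathbb{F}_n^+}x_g\lambda_g$ (finite sum). *)

(* Defs.v *)
From HB Require Import structures.
From mathcomp Require Import all_boot all_order all_algebra.
From mathcomp Require Import all_classical all_reals all_analysis.
From mathcomp Require Import complex.
Set Implicit Arguments. Unset Strict Implicit. Unset Printing Implicit Defensive.
Import Order.TTheory GRing.Theory Num.Theory.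
Local Open Scope ring_scope.
Local Open Scope classical_set_scope.
Local Open Scope complex_scope.

(* A letter is (i, b): generator g_(i+1) if b = true, its inverse if b = false. *)
Definition letter (n : nat) := ('I_n * bool)%type.
(* A word in the letters; every element of F_n is represented by a word, and two
   words represent the same element iff they have the same free reduction. *)
Definition word (n : nat) := seq (letter n).

Fixpoint reduce (n : nat) (w : word n) : word n :=
  match w with
  | [::] => [::]
  | a :: w0 =>
    match reduce w0 with
    | b :: w1 => if (b.1 == a.1) && (b.2 == ~~ a.2) then w1 else a :: b :: w1
    | [::] => [:: a]
    end
  end.

Definition wmul n (g h : word n) : word n := reduce (g ++ h).
Definition winv n (g : word n) : word n := rev (map (fun a : letter n => (a.1, ~~ a.2)) g).
Definition wlen n (g : word n) : nat := size (reduce g).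

(* A polynomial sum_g x_g lambda_g is given by a finite list of terms (g, c),
   standing for the finite sum of the c * lambda_g. *)
Definition fpoly (n : nat) (R : realType) := seq (word n * R[i]).

Section Poly.
Variables (n : nat) (R : realType).
Local Notation P := (fpoly n R).

Definition coef (x : P) (g : word n) : R[i] :=
  \sum_(e <- x | reduce e.1 == reduce g) e.2.

Definition pone : P := [:: ([::], 1)].
Definition pmul (x y : P) : P :=
  [seq (wmul a.1 b.1, a.2 * b.2) | a <- x, b <- y].
Definition padj (x : P) : P := [seq (winv a.1, conjc a.2) | a <- x].
Definition pexp (x : P) (k : nat) : P := iter k (pmul x) pone.
Definition tau (x : P) : R[i] := coef x [::].

Definition holomorphic (x : P) : Prop :=
  forall g : word n, coef x g != 0 -> all (fun a : letter n => a.2) (reduce g).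
Definition in_Pge (d : nat) (x : P) : Prop :=
  forall g : word n, coef x g != 0 -> (d <= wlen g)%N.
Definition in_Ple (d : nat) (x : P) : Prop :=
  forall g : word n, coef x g != 0 -> (wlen g <= d)%N.

Definition Pt (t : R) (x : P) : P :=
  [seq (a.1, (expR (- (t * (wlen a.1)%:R)))%:C * a.2) | a <- x].
Definition Lgen (x : P) : P := [seq (a.1, ((wlen a.1)%:R)%:C * a.2) | a <- x].

(* ||y||_2 = tau(y^* y)^(1/2) = l2-norm of lambda(y) delta_e *)
Definition norm2 (y : P) : R := Num.sqrt (complex.Re (tau (pmul (padj y) y))).

(* operator norm of lambda(x) on l_2(F_n), computed on the dense subspace of
   finitely supported vectors f (lambda(x) f = x * f) *)
Definition opnorm (x : P) : R :=
  sup [set r : R | exists f : P, norm2 f <= 1 /\ r = norm2 (pmul x f)].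

(* mu is the distribution of the positive operator y w.r.t. tau, i.e. the
   (unique, compactly supported) probability measure on [0,oo) with
   tau(y^k) = int s^k dmu(s) for all k (spectral measure of y in the vector
   state tau = <. delta_e, delta_e>). *)
Definition is_distribution (y : P) (mu : probability R R) : Prop :=
  mu [set s : R | s < 0] = 0%E /\
  forall k : nat, mu.-integrable setT (fun s : R => (s ^+ k)%:E) /\
    (Rintegral mu setT (fun s : R => s ^+ k))%:C = tau (pexp y k).

(* for 1 <= p < oo: ||x||_p = tau((x^* x)^(p/2))^(1/p)
   = (int s^(p/2) dmu(s))^(1/p), mu the distribution of x^* x *)
Definition Lpnorm_fin (p : R) (x : P) : R :=
  xget 0 [set r : R | exists mu : probability R R,
    is_distribution (pmul (padj x) x) mu /\
    r = powR (Rintegral mu setT (fun s : R => powR s (p / 2))) (p^-1)].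

Definition Lpnorm (p : \bar R) (x : P) : R :=
  match p with
  | EFin q => Lpnorm_fin q x
  | +oo%E => opnorm x
  | -oo%E => 0
  end.
End Poly.

(* Main.v *)
Require Import Defs.
From HB Require Import structures.
From mathcomp Require Import all_boot all_order all_fingroup all_algebra.
From mathcomp Require Import all_classical all_reals all_analysis measurable_realfun.
From mathcomp Require Import complex zify ring lra.
Set Implicit Arguments. Unset Strict Implicit. Unset Printing Implicit Defensive.
Import Order.TTheory GRing.Theory Num.Theory.
Import numFieldNormedType.Exports.
Local Open Scope ring_scope.
Local Open Scope classical_set_scope.
Local Open Scope sesquilinear_scope.

(* On a holomorphic polynomial |g| is the value at g of the homomorphism sending every
   generator to 1, so P_t and L are Fourier multipliers along the circle action
   lambda_{g_i} -> u lambda_{g_i}, |u| = 1, by trace preserving automorphisms. After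
   a shift of the degree by d, each of the four inequalities concerns a multiplier
   phi(k), k >= 0, with phi nonnegative, nonincreasing and convex (r^k, 1/(d+k) or
   (d-k)_+). Such a phi is, on a finite range, the Fourier transform of a positive
   measure of mass phi(0), so the multiplier is an average of rotations and has norm
   at most phi(0) on every L_p.

   Convexity of the L_p norm, defined here through moments, is transferred from
   matrices: F_n is residually finite, hence the moments of x^* x are those of a matrix
   in the regular representation of a finite quotient. For matrices, convexity
   of tr |Z|^p follows from the singular value decomposition, Bessel's
   inequality and Young's inequality; a moment problem on [0, M] provides the
   distribution of x^* x, and the Weierstrass theorem passes to the limit. *)

(** * Free reduction and residual finiteness *)

(** The bounds from below are bounds from above for the inverse multiplier. With k = |g| - d, the
    map sending L x to x has symbol 1/(d+k) on degrees at least d; with k = d - |g|, the map sending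
    P_t x to x has symbol e^(td) e^(-tk) on degrees at most d. Monotonicity and convexity are always
    those of a function of k, the distance to the extreme degree d. The obstacle is the form of the
    norm: for finite p it is computed from some measure, picked by [xget], with the moments of x^*
    x. That one exists is the moment problem; that the choice does not affect the norm follows from
    polynomial approximation. A finite quotient computes tau only on words of bounded length, so the
    quotient is chosen after the error, and inequalities are reached up to an arbitrary e > 0. The
    case p = oo rests on p = 2: for a fixed vector f, the product y f is a nonnegative combination
    of the products of f with rotated copies of x, and [norm2] is the norm for p = 2. *)

Section FreeGroup.
Variable n : nat.
Implicit Types (a b : letter n) (u v w : word n).

Definition linv a : letter n := (a.1, ~~ a.2).

Lemma linvK : involutive linv.
Proof. by case=> i b; rewrite /linv /= negbK. Qed.

(** Van der Waerden's device: on reduced words [lact a] is a bijection with inverse [lact (linv a)],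
    so words act on reduced words, and compatibility of [reduce] with concatenation is read off from
    this action. *)
Definition lact a w : word n :=
  if w is b :: w1 then
    if (b.1 == a.1) && (b.2 == ~~ a.2) then w1 else a :: b :: w1
  else [:: a].

Lemma reduceE w : reduce w = foldr lact [::] w.
Proof. by elim: w => //= a w ->. Qed.

Definition reduced w := reduce w == w.

(** A cancellation against a would leave a word shorter than w, whereas it should leave a :: w. *)
Lemma lact_reduced_tail a w : reduced (a :: w) -> reduced w.
Proof.
rewrite /reduced /=; case e: (reduce w) => [|b w1].
  by move/eqP=> [<-].
case: ifP => [_ /eqP ew1|_ /eqP[<-] //].
have sz v : (size (reduce v) <= size v)%N.
  elim: v => //= c v; case: (reduce v) => //= d v1 Iv.
  by case: ifP => _ //=; rewrite leqW // ltnW.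
by have := sz w; rewrite e ew1 /= => /ltnW; rewrite ltnn.
Qed.

Lemma lact_is_reduced a w : reduced w -> reduced (lact a w).
Proof.
case: w => [_|b w rw]; first by rewrite /reduced /=.
have e : reduce (b :: w) = b :: w by exact/eqP.
rewrite /lact; case: ifP => h; first exact: (lact_reduced_tail (a := b)).
by rewrite /reduced -[reduce _]/(lact a (reduce (b :: w))) e /= h.
Qed.

Lemma reduce_reduced w : reduced (reduce w).
Proof.
elim: w => [|a w Iw]; first exact: eqxx.
exact: (lact_is_reduced a Iw).
Qed.

Lemma reduce_idem w : reduce (reduce w) = reduce w.
Proof. exact/eqP/reduce_reduced. Qed.

Lemma lactK a w : reduced w -> lact (linv a) (lact a w) = w.
Proof.
case: w => [_|b w rw] /=; first by rewrite /linv /= eqxx negbK eqxx.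
case: ifP => [/andP[/eqP e1 /eqP e2]|h] /=; last by rewrite eqxx negbK eqxx.
have -> : linv a = b by rewrite /linv -e1 -e2 -surjective_pairing.
case: w rw => [//|c w] rw.
(* A second cancellation, now between b and c, would contradict that b :: c :: w is reduced. *)
rewrite /=; case: ifP => // h; move: rw; rewrite /reduced => /eqP rw.
have := lact_reduced_tail (introT eqP rw) => /eqP rw'.
have : reduce (b :: c :: w) = lact b (reduce (c :: w)) by [].
rewrite rw rw' /= h => /(congr1 size) /= /eqP.
by rewrite -addn2 -{2}(addn0 (size w)) eqn_add2l.
Qed.

Definition wact w v : word n := foldr lact v w.

Lemma wact_reduced w v : reduced v -> reduced (wact w v).
Proof. by elim: w => //= a w Iw /Iw; exact: lact_is_reduced. Qed.

Lemma wact_cat u w v : wact (u ++ w) v = wact u (wact w v).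
Proof. by rewrite /wact foldr_cat. Qed.

Lemma reduce_cat u w : reduce (u ++ w) = wact u (reduce w).
Proof. by rewrite !reduceE -[RHS]wact_cat. Qed.

Lemma wact_lact a w v : reduced v -> wact (lact a w) v = lact a (wact w v).
Proof.
case: w => [//|b w] rv /=; case: ifP => // /andP[/eqP e1 /eqP e2].
have -> : b = linv a by rewrite /linv -e1 -e2 -surjective_pairing.
by rewrite -{1}(linvK a) lactK // wact_reduced.
Qed.

(** A cancelling pair of letters acts trivially by [lactK], so a word and its reduction act alike;
    hence the product on reduced words is well defined. *)
Lemma wact_reduce w v : reduced v -> wact (reduce w) v = wact w v.
Proof. by elim: w => //= a w Iw rv; rewrite (wact_lact a (reduce w) rv) Iw. Qed.

Lemma reduce_catl u w : reduce (reduce u ++ w) = reduce (u ++ w).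
Proof. by rewrite !reduce_cat wact_reduce // reduce_reduced. Qed.

Lemma reduce_catr u w : reduce (u ++ reduce w) = reduce (u ++ w).
Proof. by rewrite !reduce_cat reduce_idem. Qed.

Lemma size_lact a w : (size (lact a w) <= (size w).+1)%N.
Proof. by case: w => //= b w; case: ifP => // _; rewrite ltnW // ltnW. Qed.

Lemma size_reduce w : (size (reduce w) <= size w)%N.
Proof. by elim: w => //= a w Iw; exact: leq_trans (size_lact a (reduce w)) _. Qed.

Lemma winv_cons a w : winv (a :: w) = winv w ++ [:: linv a].
Proof. by rewrite /winv map_cons rev_cons cats1. Qed.

Lemma size_winv w : size (winv w) = size w.
Proof. by rewrite /winv size_rev size_map. Qed.

(** Induction on A: an extension s for A minus a is corrected by the transposition of s a and f a,
    which moves no other value of f. It turns partial left multiplications on a ball of words into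
    permutations. *)
Lemma perm_extend (T : finType) (A : {set T}) (f : T -> T) :
  {in A &, injective f} -> exists s : {perm T}, {in A, s =1 f}.
Proof.
move: {2}#|A| (erefl #|A|) => m; elim: m A => [|m IH] A cA fi.
  by exists 1%g => x; rewrite (cards0_eq cA) inE.
have /card_gt0P[a aA] : (0 < #|A|)%N by rewrite cA.
have cAa : #|A :\ a| = m by move: cA; rewrite (cardsD1 a) aA /= => -[].
have fi' : {in A :\ a &, injective f}.
  by move=> x y /setD1P[_ xA] /setD1P[_ yA]; exact: fi.
have [s sf] := IH _ cAa fi'.
exists (s * tperm (s a) (f a))%g => x xA; rewrite permM.
have [->|xa] := eqVneq x a; first by rewrite tpermL.
have xAa : x \in A :\ a by rewrite !inE xa.
rewrite tpermD.
- exact: sf.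
- by rewrite (inj_eq perm_inj) eq_sym.
- by rewrite sf //; apply: contra xa => /eqP/(fi _ _ aA xA) ->.
Qed.

(** * Finite quotients acting on a ball of words *)

Section FinitePermutations.
Variable K : nat.
Local Notation T := {bseq K of letter n}.

(** Words longer than K fall to the default, the empty word; [trunc] is evaluated only where the
    length is at most K. *)
Let trunc w : T := insubd [bseq] w.

Let truncE w : (size w <= K)%N -> trunc w = w :> word n.
Proof. by move=> sw; rewrite val_insubd sw. Qed.

(* The words on which left multiplication by g_i stays in the ball of radius K. *)
Let dom (i : 'I_n) : {set T} :=
  [set h : T | reduced h & (size (lact (i, true) h) <= K)%N].

Let lact_trunc_inj i :
  {in dom i &, injective (fun h : T => trunc (lact (i, true) h))}.
Proof.
move=> g h; rewrite !inE => /andP[rg sg] /andP[rh sh] /(congr1 val) /=.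
rewrite !truncE // => /(congr1 (lact (linv (i, true)))).
by rewrite !lactK // => /val_inj.
Qed.

Let ex_gen i : {s : {perm T} | {in dom i, s =1 fun h : T => trunc (lact (i, true) h)}}.
Proof. exact: cid (perm_extend (@lact_trunc_inj i)). Qed.

Let lperm a : {perm T} :=
  if a.2 then projT1 (ex_gen a.1) else (projT1 (ex_gen a.1))^-1%g.

Let lpermV a : lperm (linv a) = (lperm a)^-1%g.
Proof. by case: a => i [] //=; rewrite /lperm /= invgK. Qed.

Let lpermE a (h : T) : reduced h -> (size (lact a h) <= K)%N ->
  lperm a h = trunc (lact a h).
Proof.
case: a => i [] rh sh; rewrite /lperm /=; case: (ex_gen i) => s /= sE.
  by rewrite sE // inE rh.
apply: (canLR (permK s)); rewrite sE ?inE truncE //; last first.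
  by rewrite lact_is_reduced // -[(i, true)]/(linv (i, false)) lactK //= (valP h).
by apply/val_inj; rewrite -[(i, true)]/(linv (i, false)) lactK //= truncE // (valP h).
Qed.

(* Permutations compose from left to right, so this is an antihomomorphism. *)
Definition wperm w : {perm T} := foldr (fun a s => s * lperm a)%g 1%g w.

Lemma wperm_cat u w : wperm (u ++ w) = (wperm w * wperm u)%g.
Proof. by elim: u => [|a u IH] /=; rewrite ?mulg1 // IH mulgA. Qed.

Lemma wperm_winv w : wperm (winv w) = (wperm w)^-1%g.
Proof.
elim: w => [|a w IH]; first by rewrite invg1.
by rewrite winv_cons wperm_cat /= IH mul1g lpermV invMg.
Qed.

Let wperm_lact a w : wperm (lact a w) = (wperm w * lperm a)%g.
Proof.
case: w => [//|b w] /=; case: ifP => // /andP[/eqP e1 /eqP e2].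
have -> : b = linv a by rewrite /linv -e1 -e2 -surjective_pairing.
by rewrite lpermV -mulgA mulVg mulg1.
Qed.

Lemma wperm_reduce w : wperm (reduce w) = wperm w.
Proof. by rewrite reduceE; elim: w => //= a w IH; rewrite wperm_lact IH. Qed.

(** The orbit of the empty word stays in the ball, since every suffix of w reduces to a word of
    length at most K; there the extended permutations are genuine left multiplications. *)
Let wperm_nil w : (size w <= K)%N -> wperm w (trunc [::]) = trunc (reduce w).
Proof.
elim: w => [|a w IH] /= sw; first by rewrite perm1.
have sr : (size (reduce w) <= K)%N by rewrite (leq_trans (size_reduce w)) // ltnW.
have sa : (size (lact a (reduce w)) <= K)%N.
  by apply: leq_trans (size_reduce (a :: w)) sw.
rewrite permM (IH (ltnW sw)).
have := @lpermE a (trunc (reduce w)); rewrite (truncE sr); apply=> //.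
exact: reduce_reduced.
Qed.

(** Quantitative residual finiteness: the image of the empty word already recovers the reduction of
    w. *)
Lemma wperm_eq1 w : (size w <= K)%N -> wperm w = 1%g -> reduce w = [::].
Proof.
move=> sw w1; have := wperm_nil sw; rewrite w1 perm1 => /(congr1 val) /=.
by rewrite (truncE (leq_trans (size_reduce w) sw)) (@truncE [::] (leq0n K)).
Qed.

End FinitePermutations.
End FreeGroup.

(** * Weierstrass approximation and positive definite sequences *)

Section Weierstrass.
Variable R : realType.
Implicit Types (f : R -> R) (s : R).

Definition bernstein_basis N k s : R := (s ^+ k * (1 - s) ^+ (N - k)) *+ 'C(N, k).

Lemma bernstein_basis_ge0 N k s : 0 <= s <= 1 -> 0 <= bernstein_basis N k s.
Proof.
by move=> /andP[s0 s1]; rewrite mulrn_wge0 // mulr_ge0 ?exprn_ge0 // subr_ge0.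
Qed.

Lemma bernstein_basis_sum N s : \sum_(k < N.+1) bernstein_basis N k s = 1.
Proof.
rewrite -[RHS](expr1n R N) -[1 in RHS](subrK s) exprDn.
by apply: eq_bigr => k _; rewrite /bernstein_basis mulrC.
Qed.

(** The absorption identity for binomial coefficients; it produces both factorial moments of the
    binomial law. *)
Lemma bernstein_basisS N k s :
  bernstein_basis N.+1 k.+1 s *+ k.+1 = (s * bernstein_basis N k s) *+ N.+1.
Proof.
rewrite /bernstein_basis subSS -mulrnA mulnC -mul_bin_diag /=.
by rewrite mulrnAr -mulrnA mulrA -exprS mulnC.
Qed.

Lemma bernstein_mean N s :
  \sum_(k < N.+1) k%:R * bernstein_basis N k s = N%:R * s.
Proof.
case: N => [|N]; first by rewrite big_ord1 !mul0r.
rewrite big_ord_recl mul0r add0r.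
under eq_bigr => k _ do rewrite /= mulr_natl bernstein_basisS -mulr_natl mulrA.
by rewrite -mulr_sumr bernstein_basis_sum mulr1.
Qed.

Lemma bernstein_moment2 N s :
  \sum_(k < N.+1) k%:R * (k%:R - 1) * bernstein_basis N k s =
  N%:R * (N%:R - 1) * s ^+ 2.
Proof.
case: N => [|N]; first by rewrite big_ord1 !mul0r.
rewrite big_ord_recl !mul0r add0r.
have E k : k.+1%:R * (k.+1%:R - 1) * bernstein_basis N.+1 k.+1 s =
    N.+1%:R * s * (k%:R * bernstein_basis N k s).
  have e : k.+1%:R * bernstein_basis N.+1 k.+1 s = N.+1%:R * (s * bernstein_basis N k s).
    by rewrite !mulr_natl bernstein_basisS.
  rewrite -[in X in _ * X * _]natr1 addrK mulrAC e; ring.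
under eq_bigr => k _ do rewrite lift0 E.
rewrite -mulr_sumr bernstein_mean -natr1; ring.
Qed.

Lemma bernstein_variance N s :
  \sum_(k < N.+1) (k%:R - N%:R * s) ^+ 2 * bernstein_basis N k s =
  N%:R * (s * (1 - s)).
Proof.
have E k : (k%:R - N%:R * s) ^+ 2 * bernstein_basis N k s =
    k%:R * (k%:R - 1) * bernstein_basis N k s
    + ((1 - N%:R * s *+ 2) * (k%:R * bernstein_basis N k s)
       + (N%:R * s) ^+ 2 * bernstein_basis N k s) by ring.
under eq_bigr => k _ do rewrite E.
rewrite big_split big_split /= -!mulr_sumr.
rewrite bernstein_moment2 bernstein_mean bernstein_basis_sum; ring.
Qed.

Definition bernstein N f : {poly R} :=
  \sum_(k < N.+1) (f (k%:R / N%:R) *: ('X^k * (1 - 'X) ^+ (N - k))) *+ 'C(N, k).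

Lemma bernsteinE N f s :
  (bernstein N f).[s] = \sum_(k < N.+1) f (k%:R / N%:R) * bernstein_basis N k s.
Proof.
rewrite horner_sum; apply: eq_bigr => k _.
by rewrite hornerMn hornerZ hornerM !horner_exp hornerD hornerN hornerC hornerX mulrnAr.
Qed.

(** Bernstein's argument. Nodes within d of s are handled by uniform continuity; for the others the
    difference is at most 2B, and 1 <= (k - N s)^2 / (N d)^2, so Chebyshev and the variance N s (1 -
    s) <= N give the second term. *)
Lemma bernstein_close N f (e d B : R) :
  (0 < N)%N -> 0 < d -> 0 <= B ->
  (forall s, 0 <= s <= 1 -> `|f s| <= B) ->
  (forall s t, 0 <= s <= 1 -> 0 <= t <= 1 -> `|s - t| < d -> `|f s - f t| <= e) ->
  forall s, 0 <= s <= 1 ->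
  `|f s - (bernstein N f).[s]| <= e + B *+ 2 / (N%:R * d ^+ 2).
Proof.
move=> N0 d0 B0 fB fu s s01; have N0' : 0 < N%:R :> R by rewrite ltr0n.
have e0 : 0 <= e by have := fu s s s01 s01; rewrite !subrr normr0; apply.
rewrite bernsteinE -[f s]mulr1 -[X in f s * X](bernstein_basis_sum N s) mulr_sumr -sumrB.
apply: le_trans (ler_norm_sum _ _ _) _.
pose c := B *+ 2 / (N%:R * d) ^+ 2.
have c0 : 0 <= c by rewrite divr_ge0 ?mulrn_wge0 ?sqr_ge0.
apply: (@le_trans _ _ (\sum_(k < N.+1) (e * bernstein_basis N k s
    + c * ((k%:R - N%:R * s) ^+ 2 * bernstein_basis N k s)))).
  apply: ler_sum => k _; rewrite -mulrBl normrM (ger0_norm (bernstein_basis_ge0 _ _ s01)).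
  rewrite mulrA -mulrDl ler_wpM2r ?bernstein_basis_ge0 //.
  have k01 : 0 <= (k%:R / N%:R : R) <= 1.
    by rewrite divr_ge0 //= ler_pdivrMr // mul1r ler_nat -ltnS.
  have [lt_d|ge_d] := ltP `|s - k%:R / N%:R| d.
    by rewrite (le_trans (fu _ _ s01 k01 lt_d)) // lerDl mulr_ge0 // sqr_ge0.
  apply: (@le_trans _ _ (B *+ 2)).
    by rewrite (le_trans (ler_normB _ _)) // mulr2n lerD // fB.
  rewrite -[leLHS]add0r lerD // /c mulrAC ler_pdivlMr ?exprn_gt0 ?mulr_gt0 //.
  rewrite ler_wpM2l ?mulrn_wge0 // -[leRHS]real_normK ?num_real //.
  rewrite lerXn2r ?nnegrE ?mulr_ge0 ?(ltW N0') ?(ltW d0) //.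
  have -> : k%:R - N%:R * s = - (N%:R * (s - k%:R / N%:R)).
    by rewrite mulrBr mulrCA divff ?gt_eqF // mulr1 opprB.
  by rewrite normrN normrM (gtr0_norm N0') ler_pM2l.
rewrite big_split /= -!mulr_sumr bernstein_basis_sum mulr1 bernstein_variance lerD2l.
have : s * (1 - s) <= 1 by case/andP: s01 => *; nra.
move=> ss.
have -> : c * (N%:R * (s * (1 - s))) = B *+ 2 / (N%:R * d ^+ 2) * (s * (1 - s)).
  by rewrite /c; field; rewrite (gt_eqF N0') (gt_eqF d0).
by rewrite ler_piMr // divr_ge0 ?mulrn_wge0 // mulr_ge0 ?sqr_ge0 // ltW.
Qed.

(* Otherwise Bolzano-Weierstrass yields two sequences with a common limit
   along which the values of f stay apart. *)
Lemma segment_uniform_continuity f (a b e : R) : continuous f -> 0 < e ->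
  exists2 d, 0 < d & forall s t, a <= s <= b -> a <= t <= b -> `|s - t| < d ->
    `|f s - f t| <= e.
Proof.
move=> cf e0; apply: contrapT => H.
have {H} /choice[u uP] k : exists st : R * R, [/\ a <= st.1 <= b, a <= st.2 <= b,
    `|st.1 - st.2| < k.+1%:R^-1 & e < `|f st.1 - f st.2|].
  apply: contrapT => H1; apply: H; exists k.+1%:R^-1; first by rewrite invr_gt0.
  move=> s t sab tab st; rewrite leNgt; apply/negP => fst_.
  by apply: H1; exists (s, t).
have bu : bounded_fun (fun k => (u k).1).
  exists (`|a| + `|b|); split; first exact: num_real.
  move=> x xab k _ /=; have [/andP[au ub] _ _ _] := uP k.
  apply: le_trans (ltW xab); rewrite ler_norml.
  have := ler_norm a; have := ler_norm b; have := ler_norm (- a); rewrite normrN.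
  have := normr_ge0 a; have := normr_ge0 b.
  by move=> *; apply/andP; split; lra.
have [g gincr /cvg_ex[/= l ul]] := bolzano_weierstrass bu.
have gk k : (k <= g k)%N.
  elim: k => // m IH; apply: leq_ltn_trans IH _.
  by move/increasing_seqP: gincr => /(_ m); rewrite ltEnat.
have vl : (u (g k)).2 @[k --> \oo] --> l.
  have -> : (fun k => (u (g k)).2) =
      (fun k => (u (g k)).1 - ((u (g k)).1 - (u (g k)).2)).
    by apply/funext => k; rewrite subKr.
  rewrite -[l]subr0; apply: cvgB; first exact: ul.
  apply/norm_cvg0P; apply: (@squeeze_cvgr _ _ _ _ (fun=> 0) (@harmonic R)).
  - near=> k; rewrite normr_ge0 /=; have [_ _ /ltW uk _] := uP (g k).
    apply: le_trans uk _; rewrite lef_pV2 ?posrE // ler_nat ltnS.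
    exact: gk.
  - exact: cvg_cst.
  - exact: cvg_harmonic.
have : `|f (u (g k)).1 - f (u (g k)).2| @[k --> \oo] --> `|f l - f l|.
  apply: cvg_norm; apply: cvgB; apply: continuous_cvg => //; exact: cf.
rewrite subrr normr0 => /cvgrPdist_lt /(_ _ e0)[k _ /(_ k (leqnn k))] /=.
rewrite sub0r normrN normr_id; have [_ _ _] := uP (g k).
by move=> /ltW /le_lt_trans h /h; rewrite ltxx.
Unshelve. all: by end_near. Qed.

Lemma weierstrass01 f (e : R) : continuous f -> 0 < e ->
  exists q : {poly R}, forall s, 0 <= s <= 1 -> `|f s - q.[s]| <= e.
Proof.
move=> cf e0; have e20 : 0 < e / 2 by rewrite divr_gt0.
have [d d0 fd] := @segment_uniform_continuity f 0 1 _ cf e20.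
have [B B0 fB] : exists2 B, 0 <= B & forall s, 0 <= s <= 1 -> `|f s| <= B.
  have cn : continuous (fun s => `|f s|) by move=> s; apply: cvg_norm; exact: cf.
  have [c _ cP] := EVT_max (@ler01 R) (continuous_subspaceT cn).
  by exists `|f c| => // s s01; apply: cP; rewrite in_itv.
pose N := (Num.truncn (B *+ 2 / (e / 2 * d ^+ 2))).+1.
exists (bernstein N f) => s s01.
apply: le_trans (bernstein_close (ltn0Sn _) d0 B0 fB fd s01) _.
rewrite [leRHS](splitr e) lerD2l ler_pdivrMr ?mulr_gt0 ?exprn_gt0 //.
rewrite mulrCA -ler_pdivrMr ?mulr_gt0 ?exprn_gt0 //; apply: ltW.
by rewrite truncnS_gt.
Qed.

Lemma weierstrass f (M e : R) : 0 < M -> continuous f -> 0 < e ->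
  exists q : {poly R}, forall s, 0 <= s <= M -> `|f s - q.[s]| <= e.
Proof.
move=> M0 cf e0.
have cfM : continuous (fun s => f (M * s)).
  by move=> s; apply: continuous_comp; [exact: mulrl_continuous|exact: cf].
have [q qP] := weierstrass01 cfM e0.
exists (q \Po (M^-1 *: 'X)) => s /andP[s0 sM].
rewrite horner_comp hornerZ hornerX.
have := qP (M^-1 * s); rewrite mulVKf ?gt_eqF //; apply.
by rewrite mulr_ge0 ?invr_ge0 ?(ltW M0) //= mulrC ler_pdivrMr // mul1r.
Qed.

(** The cut-off keeps the base where [powR] is the usual power; the distributions at hand give no
    mass to negative numbers. *)
Lemma continuous_powR_max (a : R) : 0 < a -> continuous (fun s => Num.max s 0 `^ a).
Proof.
move=> a0 x; have [x0|x0] := leP x 0.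
  rewrite /continuous_at max_r // powR0 ?gt_eqF //.
  apply/cvgrPdist_lt => e e0.
  have ea0 : 0 < e `^ a^-1 by rewrite powR_gt0.
  near=> s; rewrite sub0r normrN ger0_norm ?powR_ge0 //.
  rewrite -[ltRHS]powRr1 ?ltW // -(@mulVf _ a) ?gt_eqF // powRrM.
  rewrite gt0_ltr_powR ?nnegrE ?le_max ?lexx ?orbT ?ltW // gt_max ea0 andbT.
  near: s; apply: lt_nbhsl; exact: le_lt_trans ea0.
have powc : {for x, continuous (fun s => s `^ a)}.
  apply: differentiable_continuous; apply/derivable1_diffP.
  by apply: derivable_powR; rewrite in_itv /= x0.
rewrite /continuous_at max_l ?ltW //; apply: cvg_trans powc; apply: near_eq_cvg.
near=> s; rewrite max_l //; apply: ltW; near: s; exact: lt_nbhsr.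
Unshelve. all: by end_near. Qed.

End Weierstrass.

(** Young's inequality for the exponents p/(p-1) and p; at p = 1 the conjugate exponent is infinite
    and the claim is an equality. *)
Lemma young_powR (R : realType) (p u v : R) : 1 <= p -> 0 <= u -> 0 <= v ->
  u `^ (p - 1) * v <= (1 - p^-1) * u `^ p + p^-1 * v `^ p.
Proof.
rewrite le_eqVlt => /predU1P[<- u0 v0|p1 u0 v0].
  by rewrite subrr powRr0 invr1 subrr mul0r add0r !mul1r powRr1.
have p0 : 0 < p by rewrite (lt_trans _ p1).
have q0 : 0 < p / (p - 1) by rewrite divr_gt0 // subr_gt0.
apply: le_trans (@conjugate_powR _ _ _ (p / (p - 1)) p _ _ _ _ _) _ => //.
- by rewrite powR_ge0.
- by field; rewrite (gt_eqF p0) subr_eq0 (gt_eqF p1).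
rewrite -powRrM mulrCA divff ?subr_eq0 ?(gt_eqF p1) // mulr1.
rewrite lerD //; last by rewrite mulrC.
rewrite invf_div mulrC ler_wpM2r ?powR_ge0 // mulrBl mul1r divff ?gt_eqF //.
Qed.

(** * Convex sequences as Fourier transforms of positive measures on the circle *)

Section PositiveDefinite.
Variable R : realType.
Local Notation C := R[i].
Implicit Types (phi : nat -> R) (D m k : nat).

(* phi agrees on [0, D] with the Fourier transform of a finitely supported
   positive measure on the unit circle. *)
Definition circle_moments D phi :=
  exists N (c : 'I_N -> R) (u : 'I_N -> C),
    [/\ forall j, 0 <= c j, forall j, `|u j| = 1 &
        forall k, (k <= D)%N -> (phi k)%:C%C = \sum_j (c j)%:C%C * u j ^+ k].

Lemma circle_momentsD D phi psi : circle_moments D phi -> circle_moments D psi ->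
  circle_moments D (fun k => phi k + psi k).
Proof.
move=> [N [c [u [c0 u1 cu]]]] [M [d [v [d0 v1 dv]]]].
exists (N + M)%N.
exists (fun j : 'I_(N + M) => match fintype.split j with inl i => c i | inr i => d i end).
exists (fun j : 'I_(N + M) => match fintype.split j with inl i => u i | inr i => v i end).
split=> [j|j|k kD]; try by case: fintype.split.
rewrite rmorphD big_split_ord /= cu // dv //; congr (_ + _); apply: eq_bigr => i _.
  by rewrite (unsplitK (inl i)).
by rewrite (unsplitK (inr i)).
Qed.

Lemma circle_momentsZ D phi a : 0 <= a -> circle_moments D phi ->
  circle_moments D (fun k => a * phi k).
Proof.
move=> a0 [N [c [u [c0 u1 cu]]]]; exists N, (fun j => a * c j), u; split=> // [j|k kD].
  by rewrite mulr_ge0.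
by rewrite rmorphM /= cu // mulr_sumr; apply: eq_bigr => j _; rewrite rmorphM mulrA.
Qed.

Lemma circle_moments1 D : circle_moments D (fun=> 1).
Proof.
exists 1%N, (fun=> 1), (fun=> 1); split=> // [j|k _]; first by rewrite normr1.
by rewrite big_ord1 expr1n mulr1.
Qed.

Lemma eq_circle_moments D phi psi : (forall k, (k <= D)%N -> phi k = psi k) ->
  circle_moments D phi -> circle_moments D psi.
Proof.
move=> e [N [c [u [c0 u1 cu]]]]; exists N, c, u; split=> // k kD.
by rewrite -e // cu.
Qed.

Lemma circle_moments_sum D n (phi : nat -> nat -> R) :
  (forall i, (i < n)%N -> circle_moments D (phi i)) ->
  circle_moments D (fun k => \sum_(i < n) phi i k).
Proof.
elim: n => [|n IH] H.
  apply: (@eq_circle_moments _ (fun k => 0 * 1)) => [k _|].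
    by rewrite big_ord0 mul0r.
  exact: circle_momentsZ (circle_moments1 D).
apply: (@eq_circle_moments _ (fun k => \sum_(i < n) phi i k + phi n k)) => [k _|].
  by rewrite big_ord_recr.
by apply: circle_momentsD; [apply: IH => i ?; apply: H; exact: ltnW|exact: H].
Qed.

(** Iterated square roots of -1 give z^(2^e) = -1, so the order of z divides 2^(e+1) but not 2^e.
    The sampling below therefore uses a power of two as its number of points. *)
Lemma ex_prim_root2 e : exists z : C, z ^+ (2 ^ e.+1) = 1 /\
  forall k, (0 < k < 2 ^ e.+1)%N -> z ^+ k != 1.
Proof.
have [z zP] : exists z : C, z ^+ (2 ^ e) = -1.
  elim: e => [|e [z zP]]; first by exists (-1).
  by exists (sqrtC z); rewrite expnS exprM sqrtCK.
have z1 : z ^+ (2 ^ e.+1) = 1 by rewrite expnSr exprM zP sqrrN expr1n.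
exists z; split=> // k /andP[k0 klt]; apply/negP => /eqP zk.
have [m prim] := prim_order_exists (ltn_trans k0 klt) z1.
have /(dvdn_pfactor _ _ (isT : prime 2))[i ile em] : (m %| 2 ^ e.+1)%N.
  by rewrite (prim_order_dvd prim) z1.
have mk : (m <= k)%N by rewrite dvdn_leq // (prim_order_dvd prim) zk.
have ie : (i <= e)%N.
  rewrite -ltnS ltn_neqAle ile andbT; apply: contraTneq klt => ie.
  by rewrite -leqNgt -ie -em.
have : z ^+ (2 ^ e) == 1 by rewrite -(prim_order_dvd prim) em dvdn_exp2l.
by rewrite zP -subr_eq0 -opprD oppr_eq0 -(natrD _ 1 1) pnatr_eq0.
Qed.

Lemma root_unity_sum e (z : C) k : z ^+ e = 1 -> z ^+ k != 1 ->
  \sum_(j < e) (z ^+ j) ^+ k = 0.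
Proof.
move=> ze zk; apply: (mulfI (x := z ^+ k - 1)); first by rewrite subr_eq0.
under eq_bigr => j _ do rewrite exprAC.
by rewrite mulr0 -subrX1 exprAC ze expr1n subrr.
Qed.

(* Fejer kernel: |sum_(l < m) u^l|^2 has k-th Fourier coefficient (m - |k|)_+ ;
   sampling at the roots of unity of a large order computes it exactly. *)
Lemma circle_moments_triangle D m : circle_moments D (fun k => (m - k)%:R).
Proof.
(* More than D + m sample points exclude aliasing between the Fourier coefficients in play. *)
have [e eDm] : exists e, (D + m < 2 ^ e.+1)%N.
  by exists (D + m)%N; rewrite (leq_trans (ltn_expl _ (leqnn 2))) // leq_exp2l.
have [z [z1 zk]] := ex_prim_root2 e; set N := (2 ^ e.+1)%N in eDm z1 zk *.
have N0 : (0 < N)%N by rewrite expn_gt0.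
have nz : `|z| = 1.
  by apply/eqP; rewrite -(@pexpr_eq1 _ _ N) ?normr_ge0 // -normrX z1 normr1.
pose S j := \sum_(l < m) (z ^+ j) ^+ l.
pose c j := complex.Re (N%:R^-1 * `|S j| ^+ 2).
have cE j : (c j)%:C%C = N%:R^-1 * `|S j| ^+ 2.
  by rewrite RRe_real // ger0_real // mulr_ge0 ?invr_ge0 ?ler0n // exprn_ge0.
exists N, (fun j : 'I_N => c j), (fun j : 'I_N => z ^+ j); split=> [j|j|k kD].
- by rewrite -ler0c cE mulr_ge0 ?invr_ge0 ?ler0n // exprn_ge0.
- by rewrite normrX nz expr1n.
have conjE j l : (l < N)%N -> ((z ^+ j) ^+ l)^* = (z ^+ j) ^+ (N - l).
  move=> lN; apply: (mulfI (x := (z ^+ j) ^+ l)).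
    by rewrite -exprM expf_neq0 // -normr_eq0 nz oner_eq0.
  by rewrite -normCK !normrX nz !expr1n -exprD subnKC 1?ltnW // exprAC z1 expr1n.
(* Conjugates are written as exponents N - l', so the exponents lie strictly between 0 and 2N, and N
   is the only multiple of N there: it is hit exactly when l' = l + k. *)
have sumE t : (0 < t < N + N)%N ->
    \sum_(j < N) (z ^+ j) ^+ t = (t == N)%:R * N%:R.
  move=> /andP[t0 tN]; have [->|tN'] := eqVneq t N.
    under eq_bigr => j _ do rewrite exprAC z1 expr1n.
    by rewrite mul1r sumr_const card_ord.
  rewrite mul0r (@root_unity_sum N) //; have [tlt|tge] := ltnP t N.
    by rewrite zk // t0.
  rewrite -(subnKC tge) exprD z1 mul1r zk // subn_gt0 ltn_neqAle eq_sym tN' tge /=.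
  by rewrite ltn_subLR.
have step l : (l < m)%N -> \sum_(j < N) \sum_(l' < m)
    (z ^+ j) ^+ (l + (N - l') + k) = (l + k < m)%:R * N%:R.
  move=> lm; rewrite exchange_big /=.
  have l'N (l' : 'I_m) : (l' < N)%N.
    by rewrite (ltn_trans (ltn_ord l')) // (leq_ltn_trans _ eDm) // leq_addl.
  have E (l' : 'I_m) : \sum_(j < N) (z ^+ j) ^+ (l + (N - l') + k) =
      (l' == l + k :> nat)%:R * N%:R.
    have := l'N l' => lN.
    rewrite sumE; first by congr (_%:R * _); congr nat_of_bool; lia.
    lia.
  under eq_bigr => l' _ do rewrite E.
  rewrite -mulr_suml; congr (_ * _); have [lk|lk] := ltnP (l + k) m.
    rewrite (bigD1 (Ordinal lk)) //= eqxx big1 ?addr0 // => i /eqP ni.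
    by case: eqP => // e'; case: ni; apply: val_inj.
  by rewrite big1 // => i _; rewrite ltn_eqF // (leq_trans (ltn_ord i)).
have ckE j : (c j)%:C%C * (z ^+ j) ^+ k =
    N%:R^-1 * \sum_(l < m) \sum_(l' < m) (z ^+ j) ^+ (l + (N - l') + k).
  rewrite cE normCK /S rmorph_sum /= -mulrA; congr (_ * _).
  rewrite !mulr_suml; apply: eq_bigr => l _.
  rewrite mulr_sumr mulr_suml; apply: eq_bigr => l' _.
  rewrite conjE -?exprD //.
  by rewrite (ltn_trans (ltn_ord l')) // (leq_ltn_trans _ eDm) // leq_addl.
under eq_bigr => j _ do rewrite ckE.
rewrite -mulr_sumr exchange_big /=.
under eq_bigr => l _ do rewrite step //.
rewrite -mulr_suml mulrC mulfK ?pnatr_eq0 ?gtn_eqF //.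
rewrite -natr_sum raddfMn /= -[RHS]/(_%:R) ; congr (_%:R).
under eq_bigr => l _ do rewrite addnC -ltn_subRL.
have -> : \sum_(l < m) (l < m - k : nat) = \sum_(l < m | (l < m - k)%N) 1%N.
  by rewrite [RHS]big_mkcond; apply: eq_bigr => l _; case: ifP.
by rewrite -(big_ord_widen m (fun=> 1%N)) ?leq_subr // sum1_card card_ord.
Qed.

(** A discrete Polya criterion: two summations by parts, stopped at D, write phi on [0, D] as a
    combination of the constant 1 and the triangles (j - k)_+ . The coefficients phi(D), phi(D) -
    phi(D+1) and the second differences are nonnegative by hypothesis. *)
Lemma circle_moments_convex D phi :
  (forall k, 0 <= phi k) -> (forall k, phi k.+1 <= phi k) ->
  (forall k, phi k.+1 *+ 2 <= phi k + phi k.+2) -> circle_moments D phi.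
Proof.
move=> phi0 phi1 phi2.
have taylor m k : (k <= m)%N -> phi k = phi m * 1 + (phi m - phi m.+1) * (m - k)%:R +
    \sum_(i < m) (phi i - phi i.+1 *+ 2 + phi i.+2) * (i.+1 - k)%:R.
  elim: m => [|m IH] in k *; first by rewrite leqn0 => /eqP ->; rewrite big_ord0 subnn; ring.
  rewrite leq_eqVlt => /predU1P[->|km].
    rewrite subnn mulr0 !addr0 mulr1 big1 ?addr0 // => i _.
    by rewrite (eqP (ltn_ord i : i.+1 - m.+1 == 0)%N) mulr0.
  by rewrite big_ord_recr /= (IH k) // subSn // -natr1; ring.
apply: (@eq_circle_moments _ (fun k => phi D * 1 + (phi D - phi D.+1) * (D - k)%:R +
    \sum_(i < D) (phi i - phi i.+1 *+ 2 + phi i.+2) * (i.+1 - k)%:R)).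
  by move=> k kD; rewrite -taylor.
apply: circle_momentsD; first apply: circle_momentsD.
- exact: circle_momentsZ (circle_moments1 D).
- by apply: circle_momentsZ; [rewrite subr_ge0|exact: circle_moments_triangle].
- apply: (@circle_moments_sum _ _ (fun i k =>
    (phi i - phi i.+1 *+ 2 + phi i.+2) * (i.+1 - k)%:R)) => i _.
  apply: circle_momentsZ.
    by rewrite addrAC subr_ge0.
  exact: circle_moments_triangle.
Qed.

End PositiveDefinite.

(** * The Hausdorff moment problem *)

(** The Lebesgue-Stieltjes measure of F, read as the law of the identity. *)
Lemma ex_probability_of_cdf (R : realType) (F : R -> R) (M : R) :
  {homo F : a b / a <= b} ->
  (forall a e, 0 < e -> exists2 d, 0 < d & F (a + d) <= F a + e) ->
  (forall a, a < 0 -> F a = 0) -> (forall a, M <= a -> F a = 1) ->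
  exists mu : probability R R, forall a, mu `]-oo, a] = (F a)%:E.
Proof.
move=> Fh Fr F0 F1.
have Fnd : nondecreasing F by [].
have Frc : right_continuous F.
  move=> a; apply/cvgrPdist_le => e e0; have [d d0 Fd] := Fr a e e0.
  near=> s.
  have as_ : a < s by near: s; exact: nbhs_right_gt.
  have sad : s < a + d by near: s; apply: nbhs_right_lt; rewrite ltrDl.
  have sF := Fh _ _ (ltW sad); have aF := Fh _ _ (ltW as_).
  by rewrite distrC ger0_norm ?subr_ge0 // lerBlDl (le_trans sF).
have FNy : F @ -oo --> (0 : R).
  apply: cvg_near_cst; near=> s; apply: F0; near: s; exact: nbhs_ninfty_lt.
have Fy : F @ +oo --> (1 : R).
  apply: cvg_near_cst; near=> s; apply: F1; near: s; exact: nbhs_pinfty_ge (num_real M).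
pose f : cumulativeBounded (0:R) (1:R) := HB.pack F
  (isCumulative.Build R _ R F Fnd Frc) (isCumulativeBounded.Build R 0 1 F FNy Fy).
have mid : measurable_fun setT (idfun : measurableTypeR R -> R) by exact: measurable_id.
pose X : {mfun measurableTypeR R >-> R} :=
  HB.pack (idfun : measurableTypeR R -> R) (isMeasurableFun.Build _ _ _ _ _ mid).
exists (distribution (lebesgue_stieltjes_measure f) X) => a.
exact: (cdf_lebesgue_stieltjes_id f a).
Unshelve. all: by end_near. Qed.

(** * Integrals against a measure concentrated on a set *)

Section Concentrated.
Variables (R : realType) (mu : probability R R) (D : set R).
Hypotheses (mD : measurable D) (muD : mu (~` D) = 0%E).
Implicit Types f g : R -> R.

Lemma integrable_concentrated f B : measurable_fun setT f ->
  (forall s, D s -> `|f s| <= B) -> mu.-integrable setT (EFin \o f).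
Proof.
move=> mf fB.
move/measurable_EFinP: (mf) => mEf.
apply/(negligible_integrable (measurableC mD) measurableT mEf muD).
rewrite setTD setCK; apply: measurable_bounded_integrable => //.
- by rewrite (le_lt_trans (probability_le1 mu mD)) // ltry.
- exact: measurable_funTS.
- exists B; split; first exact: num_real.
  by move=> x Bx s Ds /=; exact: le_trans (fB _ Ds) (ltW Bx).
Qed.

Lemma Rintegral_concentrated f : mu.-integrable setT (EFin \o f) ->
  Rintegral mu setT f = Rintegral mu D f.
Proof.
move=> fi; rewrite /Rintegral (negligible_integral (measurableC mD) measurableT fi muD).
by rewrite setTD setCK.
Qed.

Lemma le_Rintegral_concentrated f g : mu.-integrable setT (EFin \o f) ->
  mu.-integrable setT (EFin \o g) -> (forall s, D s -> f s <= g s) ->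
  Rintegral mu setT f <= Rintegral mu setT g.
Proof.
move=> fi gi fg; rewrite !Rintegral_concentrated //; apply: le_Rintegral => //.
- exact: integrableS fi.
- exact: integrableS gi.
Qed.

Lemma Rintegral_linear n (c : 'I_n -> R) (g : 'I_n -> R -> R) :
  (forall j, mu.-integrable setT (EFin \o g j)) ->
  mu.-integrable setT (EFin \o (fun s => \sum_j c j * g j s)) /\
  Rintegral mu setT (fun s => \sum_j c j * g j s) =
  \sum_j c j * Rintegral mu setT (g j).
Proof.
elim: n c g => [|n IH] c g gi.
  rewrite big_ord0 (_ : (fun s => _) = cst 0); last first.
    by apply/funext => s; rewrite big_ord0.
  by split; [exact: finite_measure_integrable_cst|rewrite Rintegral_cst ?mul0r].
rewrite big_ord_recl (_ : (fun s => _) = (fun s => c ord0 * g ord0 s +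
  \sum_j c (lift ord0 j) * g (lift ord0 j) s)); last first.
  by apply/funext => s; rewrite big_ord_recl.
have [i2 e2] := IH (fun j => c (lift ord0 j)) (fun j => g (lift ord0 j)) (fun j => gi _).
have i3 : mu.-integrable setT (EFin \o (fun s : R => c ord0 * g ord0 s)).
  exact: integrableZl (gi ord0).
split; first exact: integrableD i3 i2.
by rewrite RintegralD // RintegralZl // e2.
Qed.

End Concentrated.

Section FiniteAverages.
Variable R : realType.

Definition average N (lam : 'I_N -> R) (f : R -> R) := (\sum_i f (lam i)) / N%:R.

Lemma average_le N (lam : 'I_N -> R) M f g : (forall i, 0 <= lam i <= M) ->
  (forall s, 0 <= s <= M -> f s <= g s) -> average lam f <= average lam g.
Proof.
move=> lamM fg; rewrite ler_wpM2r ?invr_ge0 ?ler0n //.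
by apply: ler_sum => i _; exact: fg.
Qed.

Lemma averageD N (lam : 'I_N -> R) f g :
  average lam (fun s => f s + g s) = average lam f + average lam g.
Proof. by rewrite /average big_split mulrDl. Qed.

Lemma averageZ N (lam : 'I_N -> R) c f :
  average lam (fun s => c * f s) = c * average lam f.
Proof. by rewrite /average -mulr_sumr mulrA. Qed.

Lemma average_cst N (lam : 'I_N -> R) c : (0 < N)%N -> average lam (fun=> c) = c.
Proof.
move=> N0; rewrite /average sumr_const card_ord -[c *+ N]mulr_natr mulfK //.
by rewrite pnatr_eq0 -lt0n.
Qed.

(** In the application [lam] lists the squared singular values of a matrix over a finite quotient,
    which sees only finitely many moments; hence the cut-off K. *)
Definition average_match M (m : nat -> R) K N (lam : 'I_N -> R) :=
  [/\ (0 < N)%N, forall i, 0 <= lam i <= M &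
      forall k, (k <= K)%N -> m k = average lam (fun s => s ^+ k)].

End FiniteAverages.

Section Hausdorff.
Variables (R : realType) (M : R) (m : nat -> R).
Hypothesis M0 : 0 < M.
Hypothesis mP : forall K, exists N (lam : 'I_N -> R), average_match M m K lam.

(** The Riesz functional of the moment sequence, that is, the integral of q against the measure to
    be found. *)
Definition poly_mean (q : {poly R}) : R := \sum_(k < size q) q`_k * m k.

Lemma poly_meanE K N (lam : 'I_N -> R) (q : {poly R}) :
  average_match M m K lam ->  (size q <= K.+1)%N -> poly_mean q = average lam (horner q).
Proof.
move=> [N0 lamM lamE] sq; rewrite /poly_mean /average.
under [in RHS]eq_bigr => i _ do rewrite horner_coef.
rewrite exchange_big mulr_suml; apply: eq_bigr => k _ /=.
by rewrite lamE ?averageZ -?mulr_sumr -?mulrA // -ltnS (leq_trans (ltn_ord k)).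
Qed.

(** A single finite average computes the functional on q1, q2 and all c q1 + q2, as their degrees
    are bounded together; positivity and linearity are inherited from it. *)
Let poly_mean_pair q1 q2 : exists N (lam : 'I_N -> R), [/\ (0 < N)%N, forall i, 0 <= lam i <= M,
   poly_mean q1 = average lam (horner q1), poly_mean q2 = average lam (horner q2) &
   forall c, poly_mean (c *: q1 + q2) = average lam (horner (c *: q1 + q2))].
Proof.
have [N [lam lamP]] := mP (maxn (size q1) (size q2)).
exists N, lam; have [N0 lamM lamE] := lamP; split=> // [||c].
- by rewrite (poly_meanE lamP) // leqW // leq_maxl.
- by rewrite (poly_meanE lamP) // leqW // leq_maxr.
rewrite (poly_meanE lamP) // (leq_trans (size_polyD _ _)) // geq_max.
rewrite (leq_trans (size_scale_leq _ _)) ?leqW ?leq_maxl //=.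
by rewrite leq_maxr.
Qed.

Lemma poly_mean_le q1 q2 : (forall s, 0 <= s <= M -> q1.[s] <= q2.[s]) ->
  poly_mean q1 <= poly_mean q2.
Proof.
move=> q12; have [N [lam [N0 lamM -> -> _]]] := poly_mean_pair q1 q2.
exact: average_le lamM q12.
Qed.

Lemma poly_meanP c q1 q2 : poly_mean (c *: q1 + q2) = c * poly_mean q1 + poly_mean q2.
Proof.
have [N [lam [N0 lamM -> -> ->]]] := poly_mean_pair q1 q2.
rewrite -averageZ -averageD; congr (_ / _); apply: eq_bigr => i _.
by rewrite hornerD hornerZ.
Qed.

Lemma poly_mean0 : poly_mean 0 = 0.
Proof. by rewrite /poly_mean size_poly0 big_ord0. Qed.

Lemma poly_meanC c : poly_mean c%:P = c.
Proof.
have [N [lam [N0 lamM -> _ _]]] := poly_mean_pair c%:P 0.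
rewrite -[RHS](average_cst lam c N0); congr (_ / _); apply: eq_bigr => i _.
by rewrite hornerC.
Qed.

Lemma poly_meanXn k : poly_mean 'X^k = m k.
Proof.
rewrite /poly_mean size_polyXn big_ord_recr /= coefXn eqxx mul1r big1 ?add0r //.
by move=> i _; rewrite coefXn ltn_eqF // mul0r.
Qed.

Lemma poly_mean_sum n (c : 'I_n -> R) (q : 'I_n -> {poly R}) :
  poly_mean (\sum_i c i *: q i) = \sum_i c i * poly_mean (q i).
Proof.
elim: n c q => [|n IH] c q; first by rewrite !big_ord0 poly_mean0.
by rewrite !big_ord_recl poly_meanP IH.
Qed.

Lemma moment_le k : 0 <= m k <= M ^+ k.
Proof.
have [N [lam lamP]] := mP k; have [N0 lamM ->//] := lamP.
rewrite -[X in _ <= _ <= X](average_cst lam _ N0) -[X in X <= _](average_cst lam 0 N0).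
apply/andP; split; apply: average_le lamM _ => s /andP[s0 sM].
  exact: exprn_ge0.
by rewrite lerXn2r ?nnegrE // ltW.
Qed.

Definition majorants a := [set q : {poly R} |
  forall s, 0 <= s <= M -> 0 <= q.[s] /\ (s <= a -> 1 <= q.[s])].

(** The upper extension of the functional to the indicator of s <= a; it will be the cumulative
    distribution function of the solution. *)
Definition mean_cdf a := inf [set poly_mean q | q in majorants a].

Let majorant1 a : majorants a 1.
Proof. by move=> s _; rewrite hornerE; split. Qed.

Let lb_majorants a : lbound [set poly_mean q | q in majorants a] 0.
Proof.
move=> _ [q qP <-]; rewrite -poly_mean0; apply: poly_mean_le => s s01.
by rewrite horner0; case: (qP s s01).
Qed.

Lemma mean_cdf_le a q : majorants a q -> mean_cdf a <= poly_mean q.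
Proof. by move=> qa; apply: ge_inf; [exists 0; exact: lb_majorants|exists q]. Qed.

Lemma mean_cdf_adherent a e : 0 < e ->
  exists2 q, majorants a q & poly_mean q <= mean_cdf a + e.
Proof.
move=> e0; have [|_ [q qa <-] /ltW qe] := @inf_adherent _ [set poly_mean q | q in majorants a] _ e0.
  by split; [exists (poly_mean 1), 1 => //|exists 0; exact: lb_majorants].
by exists q.
Qed.

Lemma mean_cdf_ge0 a : 0 <= mean_cdf a.
Proof.
by apply: lb_le_inf; [exists (poly_mean 1), 1 => //|exact: lb_majorants].
Qed.

Lemma mean_cdf_homo : {homo mean_cdf : a b / a <= b}.
Proof.
move=> a b ab; apply: lb_le_inf; first by exists (poly_mean 1), 1.
move=> _ [q qb <-]; apply: mean_cdf_le => s s01; have [q0 q1] := qb s s01.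
by split=> // sa; apply: q1; exact: le_trans ab.
Qed.

Lemma mean_cdf_lt0 a : a < 0 -> mean_cdf a = 0.
Proof.
move=> a0; apply/le_anti; rewrite mean_cdf_ge0 andbT -poly_mean0.
apply: mean_cdf_le => s /andP[s0 _]; rewrite horner0; split=> // /(le_trans s0).
by rewrite leNgt a0.
Qed.

Lemma mean_cdf_geM a : M <= a -> mean_cdf a = 1.
Proof.
move=> Ma; apply/le_anti/andP; split.
  by rewrite -(poly_meanC 1); exact: mean_cdf_le.
apply: lb_le_inf; first by exists (poly_mean 1), 1.
move=> _ [q qa <-]; rewrite -(poly_meanC 1); apply: poly_mean_le => s s01.
rewrite hornerC; case: (qa s s01) => _; apply; case/andP: s01 => _ sM.
exact: le_trans Ma.
Qed.

(** A nearly optimal majorant q for a stays above 1 - e/2 slightly to the right of a, so q + e/2 is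
    a majorant for a + d with d small. Outside [0, M[ the function is locally constant to the
    right. *)
Lemma mean_cdf_right_continuous a e : 0 < e ->
  exists2 d, 0 < d & mean_cdf (a + d) <= mean_cdf a + e.
Proof.
move=> e0; have [aM|Ma] := leP M a.
  exists 1 => //; have aM1 : M <= a + 1 by rewrite (le_trans aM) // lerDl.
  by rewrite (mean_cdf_geM aM) (mean_cdf_geM aM1) lerDl ltW.
have [a0|a0] := ltP a 0.
  exists (- a / 2); first by rewrite divr_gt0 ?oppr_gt0.
  by rewrite !mean_cdf_lt0 ?add0r ?ltW //; lra.
have e20 : 0 < e / 2 by rewrite divr_gt0.
have [q qa qe] := mean_cdf_adherent a e20.
have /cvgrPdist_lt /(_ _ e20) [d /= d0 dP] := @continuous_horner _ q a.
exists (d / 2); first by rewrite divr_gt0.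
rewrite (splitr e) addrA; apply: le_trans (lerD qe (lexx _)).
have -> : poly_mean q + e / 2 = poly_mean (1 *: q + (e / 2)%:P).
  by rewrite poly_meanP poly_meanC mul1r.
apply: mean_cdf_le => s s01; have [q0 q1] := qa s s01.
rewrite scale1r hornerD hornerC; split; first by rewrite addr_ge0 // ltW.
move=> sad; have [sa|as_] := leP s a; first by rewrite ler_wpDr ?q1 // ltW.
have [|_ q1a] := qa a; first by rewrite a0 ltW.
have := q1a (lexx _); have : `|q.[a] - q.[s]| < e / 2.
  apply: dP; rewrite /ball_ /= ler0_norm ?subr_le0 ?ltW // opprB ltrBlDl.
  by rewrite (le_lt_trans sad) // ltrD2l ltr_pdivrMr // ltr_pMr // ltr1n.
by rewrite ltr_norml => /andP[? ?] ?; lra.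
Qed.

(** A polynomial e-close to the continuous ramp falling from 1 at a to 0 at a + w, raised by e so as
    to dominate the indicator; hence the error 2e above. *)
Lemma ramp_poly (a w e : R) : 0 < w -> 0 < e -> exists q : {poly R},
  forall s, 0 <= s <= M -> (s <= a)%R%:R <= q.[s] <= (s <= a + w)%R%:R + e *+ 2.
Proof.
(* [f] is the affine function [y] clamped to [0, 1], written with absolute values. *)
move=> w0 e0; pose y s := 1 - (s - a) / w.
pose f s := (1 + `|y s| - `|y s - 1|) / 2.
have cy : continuous y.
  move=> s; apply: cvgB; first exact: cvg_cst.
  by apply: cvgM; [apply: cvgB; [exact: cvg_id|exact: cvg_cst]|exact: cvg_cst].
have cf : continuous f.
  move=> s; apply: cvgM; last exact: cvg_cst.
  apply: cvgB.
    by apply: cvgD; [exact: cvg_cst|apply: cvg_norm; exact: cy].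
  by apply: cvg_norm; apply: cvgB; [exact: cy|exact: cvg_cst].
have [q qP] := weierstrass M0 cf e0.
exists (q + e%:P) => s s01; rewrite hornerD hornerC.
have := qP s s01; rewrite ler_norml => /andP[q1 q2].
have f01 : 0 <= f s <= 1.
  rewrite /f; have := ler_norm (y s); have := ler_norm (- y s); rewrite normrN.
  have := ler_norm (y s - 1); have := ler_norm (- (y s - 1)); rewrite normrN.
  have := ler_normD (y s - 1) 1; rewrite subrK normr1.
  have := ler_normD (y s) (- 1); rewrite normrN normr1.
  have := ler_normD (1 - y s) (y s); rewrite subrK normr1 distrC.
  by move=> *; apply/andP; split; lra.
have fl : s <= a -> f s = 1.
  move=> sa; have y1 : 1 <= y s.
    by rewrite /y lerBrDl gerDr mulr_le0_ge0 ?subr_le0 // invr_ge0 ltW.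
  by rewrite /f ger0_norm ?(le_trans ler01) // ger0_norm ?subr_ge0 //; field.
have fr : a + w < s -> f s = 0.
  move=> sa; have y0 : y s <= 0.
    by rewrite /y subr_le0 ler_pdivlMr // mul1r; lra.
  by rewrite /f ler0_norm // ler0_norm; [field|lra].
case/andP: f01 => f0 f1.
have [sa|sa] := leP s a; have [saw|saw] := leP s (a + w); rewrite mulr2n /=.
- by have := fl sa; move=> *; apply/andP; split; lra.
- by have := fl sa; have := fr saw; lra.
- by apply/andP; split; lra.
- by have := fr saw; move=> *; apply/andP; split; lra.
Qed.

(** M^k - s^k is squeezed between two step functions in the indicators of s <= a_j. Integrals of
    these indicators are values of [mean_cdf], which polynomials compare with the functional, so the
    integral of s^k and m k differ by arbitrarily little. *)
Lemma hausdorff_moment : exists mu : probability R R,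
  [/\ mu [set s | s < 0] = 0%E, mu (~` `[0, M]) = 0%E &
  forall k, mu.-integrable setT (fun s : R => (s ^+ k)%:E) /\
    Rintegral mu setT (fun s : R => s ^+ k) = m k].
Proof.
have [mu muE] := ex_probability_of_cdf mean_cdf_homo mean_cdf_right_continuous
  mean_cdf_lt0 mean_cdf_geM.
have mneg : measurable [set s : R | s < 0].
  by rewrite -set_itvNyo; exact: measurable_itv.
have mu0 : mu [set s | s < 0] = 0%E.
  apply/negligibleP => //.
  rewrite (_ : [set s | s < 0] = \bigcup_k `]-oo, (- k.+1%:R^-1)%R]); last first.
    apply/seteqP; split=> [s /= s0|s [k _]] /=.
      have /ltr_add_invr[k] := s0; rewrite -ltrBrDr sub0r => /ltW sk.
      by exists k => //=; rewrite in_itv.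
    by rewrite in_itv /= => /le_lt_trans; apply; rewrite oppr_lt0 invr_gt0.
  apply: negligible_bigcup => k; apply/negligibleP; first exact: measurable_itv.
  by apply: (etrans (muE _)); rewrite mean_cdf_lt0 // oppr_lt0 invr_gt0.
have muM : mu (~` `]-oo, M]) = 0%E.
  by rewrite probability_setC ?muE ?mean_cdf_geM ?subee.
have mD : measurable (`[0, M] : set R) by exact: measurable_itv.
have muD : mu (~` `[0, M]) = 0%E.
  apply/negligibleP; first exact: measurableC.
  apply: (@negligibleS _ _ _ _ ([set s | s < 0] `|` ~` `]-oo, M])).
    move=> s /= /negP; rewrite !in_itv /= negb_and -ltNge => /orP[s0|sM]; [by left|right].
    exact/negP.
  apply: negligibleU; first exact/negligibleP.
  by apply/negligibleP => //; apply: measurableC; exact: measurable_itv.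
have ind_int (a : R) : mu.-integrable setT (EFin \o (fun s : R => (s <= a)%R%:R)) /\
    Rintegral mu setT (fun s : R => (s <= a)%R%:R) = mean_cdf a.
  have e : (fun s : R => (s <= a)%R%:R : R) = \1_(`]-oo, a]).
    by apply/funext => s; rewrite indicE mem_setE in_itv.
  rewrite e; split; first by apply: integrable_indic; exact: measurable_itv.
  have mA : measurable (`]-oo, a] : set R) by exact: measurable_itv.
  by rewrite /Rintegral integral_indic // setIT; exact: (congr1 fine (muE a)).
exists mu; split=> // k.
have xk_int : mu.-integrable setT (EFin \o (fun s : R => s ^+ k)).
  apply: (integrable_concentrated mD muD (B := M ^+ k)); first exact: exprn_measurable.
  move=> s /=; rewrite in_itv /= => /andP[s0 sM].
  by rewrite ger0_norm ?exprn_ge0 // lerXn2r ?nnegrE // ltW.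
split=> //.
have step_int n (c : 'I_n -> R) (a : 'I_n -> R) :
    mu.-integrable setT (EFin \o (fun s : R => \sum_j c j * (s <= a j)%R%:R)) /\
    Rintegral mu setT (fun s : R => \sum_j c j * (s <= a j)%R%:R) =
    \sum_j c j * mean_cdf (a j).
  have [i e] := Rintegral_linear c (fun j => (ind_int (a j)).1).
  by split=> //; rewrite e; apply: eq_bigr => j _; rewrite (ind_int (a j)).2.
have mu1 : fine (mu setT) = 1 by rewrite probability_setT.
case: k xk_int => [|k] xk_int.
  rewrite -poly_meanXn expr0 -[1]/(1%:P) poly_meanC.
  by rewrite (Rintegral_cst mu measurableT 1) mu1 mulr1.
move: k.+1 (ltn0Sn k) xk_int => {}k k0 xk_int.
set I := Rintegral _ _ _; set T := M ^+ k.
have T0 : 0 < T by rewrite exprn_gt0.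
apply/eqP; rewrite -subr_eq0 -normr_eq0; apply/eqP/le_anti; rewrite normr_ge0 andbT.
apply/ler_addgt0Pr => e e0; rewrite add0r.
(* The errors collected below add up to 2 eta + 2 eta T. *)
pose eta := e / (2 + 2 * T).
have eta0 : 0 < eta by rewrite divr_gt0 //; lra.
have cX : continuous (fun s : R => s ^+ k) by exact: exprn_continuous.
have [d d0 dP] := @segment_uniform_continuity R _ 0 M eta cX eta0.
pose L := (Num.truncn (M / d)).+1; pose w := M / L%:R.
have L0 : 0 < L%:R :> R by rewrite ltr0n.
have w0 : 0 < w by rewrite divr_gt0.
have wd : w < d by rewrite ltr_pdivrMr // mulrC -ltr_pdivrMr // truncnS_gt.
pose a j : R := j%:R * w.
have aS j : a j.+1 = a j + w by rewrite /a -natr1 mulrDl mul1r.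
have aL : a L = M by rewrite /a /w mulrCA divff ?mulr1 // gt_eqF.
have a0 j : 0 <= a j by rewrite mulr_ge0 // ltW.
have aM j : (j <= L)%N -> a j <= M by move=> jL; rewrite -aL ler_wpM2r ?ler_nat // ltW.
pose D j := a j.+1 ^+ k - a j ^+ k.
have D0 j : 0 <= D j by rewrite subr_ge0 lerXn2r ?nnegrE // aS lerDl ltW.
have De j : (j < L)%N -> D j <= eta.
  move=> jL; rewrite -[leLHS]ger0_norm // dP ?a0 ?aM // ?(ltnW jL) //.
  by rewrite aS addrAC subrr add0r gtr0_norm.
have DT : \sum_(j < L) D j = T.
  rewrite -(big_mkord xpredT D) telescope_sumr // aL /a mul0r expr0n.
  by rewrite (gtn_eqF k0) subr0.
(* The powers max(a_j, s)^k telescope from s^k to M^k, with increment [D j] as soon as s <= a_j and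
   a nonnegative one before. *)
have lo s : 0 <= s <= M -> \sum_(j < L) D j * (s <= a j)%R%:R <= T - s ^+ k.
  move=> /andP[s0 sM]; pose g j := Num.max (a j) s ^+ k.
  apply: (@le_trans _ _ (\sum_(j < L) (g j.+1 - g j))).
    apply: ler_sum => j _; rewrite /g /D; have [sa|sa] := leP s (a j).
      by rewrite max_l ?max_l ?mulr1 // aS (le_trans sa) // lerDl ltW.
    rewrite mulr0 subr_ge0; apply: lerXn2r; rewrite ?nnegrE; last first.
    - by rewrite le_max lexx orbT.
    - by rewrite ?le_max s0 ?orbT.
    - by rewrite ?le_max s0 ?orbT.
  rewrite -(big_mkord xpredT (fun j => g j.+1 - g j)) telescope_sumr // /g aL max_l //.
  by rewrite /a mul0r max_r.
have hi s : 0 <= s <= M -> T - s ^+ k <= \sum_(j < L) D j * (s <= a j.+1)%R%:R.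
  move=> /andP[s0 sM]; pose g j := Num.max (a j) s ^+ k.
  apply: (@le_trans _ _ (\sum_(j < L) (g j.+1 - g j))); last first.
    apply: ler_sum => j _; rewrite /g /D; have [sa|sa] := leP s (a j.+1).
      rewrite mulr1; apply: lerB => //; apply: lerXn2r; rewrite ?nnegrE //.
      - by rewrite le_max s0 orbT.
      - by rewrite le_max lexx.
    have aj : a j < s by rewrite (le_lt_trans _ sa) // aS lerDl ltW.
    by rewrite (max_r (ltW aj)) subrr mulr0.
  rewrite -(big_mkord xpredT (fun j => g j.+1 - g j)) telescope_sumr // /g aL max_l //.
  by rewrite /a mul0r max_r.
(* The two step functions differ only on the cell containing s, where the jump is at most [eta]. *)
have gap s : \sum_(j < L) D j * (s <= a j.+1)%R%:R <=
    \sum_(j < L) D j * (s <= a j)%R%:R + eta.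
  have disj l : \sum_(j < l) ((s <= a j.+1)%R%:R - (s <= a j)%R%:R) <= (1 : R).
    rewrite -(big_mkord xpredT (fun j => (s <= a j.+1)%R%:R - (s <= a j)%R%:R : R)).
    by rewrite telescope_sumr //=; case: (s <= a l)%R; case: (s <= a 0%N)%R => /=; lra.
  rewrite -lerBlDl -sumrB; apply: (@le_trans _ _ (eta * 1)); last by rewrite mulr1.
  apply: (@le_trans _ _ (eta * \sum_(j < L) ((s <= a j.+1)%R%:R - (s <= a j)%R%:R))); last first.
    by rewrite ler_wpM2l // ltW.
  rewrite mulr_sumr; apply: ler_sum => j _; rewrite -mulrBr ler_wpM2r ?De //.
  rewrite subr_ge0 ler_nat; have [sa|//] := leP s (a j).
  by rewrite (le_trans sa) // aS lerDl ltW.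
have Tint c : mu.-integrable setT (EFin \o (fun s : R => c - s ^+ k)) /\
    Rintegral mu setT (fun s : R => c - s ^+ k) = c - I.
  have ci : mu.-integrable setT (EFin \o cst c) by exact: finite_measure_integrable_cst.
  split; first exact: integrableB ci xk_int.
  by rewrite RintegralB // (Rintegral_cst mu measurableT c) mu1 mulr1.
have [Ti Te] := Tint T.
have [Ti' Te'] := Tint (T + eta).
have [lo_i lo_e] := step_int L (fun j => D j) (fun j => a j).
have [hi_i hi_e] := step_int L (fun j => D j) (fun j => a j.+1).
have inD s : (`[0, M] : set R) s -> 0 <= s <= M by rewrite /= in_itv.
have Ilo : T - I <= \sum_(j < L) D j * mean_cdf (a j) + eta.
  rewrite -lo_e -Te -lerBlDr.
  have [i3 e3] := Tint (T - eta).
  rewrite Te addrAC -e3; apply: (le_Rintegral_concentrated mD muD) => // s /inD sM.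
  by rewrite addrAC lerBlDr (le_trans (hi s sM)) ?gap.
have Ihi : \sum_(j < L) D j * mean_cdf (a j.+1) <= T - I + eta.
  rewrite -hi_e addrAC -Te'; apply: (le_Rintegral_concentrated mD muD) => // s /inD sM.
  by rewrite addrAC (le_trans (gap s)) // lerD2r lo.
have TX c : poly_mean (c%:P - 'X^k) = c - m k.
  have -> : c%:P - 'X^k = (-1) *: 'X^k + c%:P by rewrite scaleN1r addrC.
  by rewrite poly_meanP poly_meanXn poly_meanC mulN1r addrC.
have mhi : T - m k <= \sum_(j < L) D j * mean_cdf (a j.+1) + eta * T.
  have /choice[q qP] : forall j, exists q : {poly R}, majorants (a j.+1) q /\
      poly_mean q <= mean_cdf (a j.+1) + eta.
    by move=> j; have [q ? ?] := mean_cdf_adherent (a j.+1) eta0; exists q.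
  apply: (@le_trans _ _ (poly_mean (\sum_(j < L) D j *: q j))).
    rewrite -TX; apply: poly_mean_le => s sM.
    rewrite hornerD hornerN hornerC hornerXn (le_trans (hi s sM)) // horner_sum.
    apply: ler_sum => j _; rewrite hornerZ ler_wpM2l //.
    have [/(_ s sM)[q0 q1] _] := qP j.
    by have [sa|_] := leP s (a j.+1); [exact: q1|exact: q0].
  rewrite poly_mean_sum -DT mulrC mulr_suml -big_split; apply: ler_sum => j _ /=.
  by rewrite -mulrDr ler_wpM2l //; case: (qP j).
(* Here a majorant must also be bounded above: ramps falling between a_j and a_(j+1) are dominated
   by the next step, up to 2 eta. *)
have mlo : \sum_(j < L) D j * mean_cdf (a j) <= T - m k + eta + eta * 2 * T.
  have /choice[q qP] : forall j, exists q : {poly R}, forall s, 0 <= s <= M ->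
      (s <= a j)%R%:R <= q.[s] <= (s <= a j.+1)%R%:R + eta *+ 2.
    by move=> j; rewrite aS; exact: ramp_poly.
  apply: (@le_trans _ _ (poly_mean (\sum_(j < L) D j *: q j))).
    rewrite poly_mean_sum; apply: ler_sum => j _; rewrite ler_wpM2l //.
    apply: mean_cdf_le => s sM; have /andP[q0 _] := qP j s sM.
    split; first by rewrite (le_trans _ q0).
    by move=> sa; move: q0; rewrite sa.
  have -> : T - m k + eta + eta * 2 * T = T + eta + eta * 2 * T - m k by ring.
  rewrite -TX; apply: poly_mean_le => s sM.
  rewrite hornerD hornerN hornerC hornerXn horner_sum.
  apply: (@le_trans _ _ (\sum_(j < L) (D j * (s <= a j.+1)%R%:R + D j * (eta *+ 2)))).
    apply: ler_sum => j _; rewrite hornerZ -mulrDr ler_wpM2l //.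
    by have /andP[] := qP j s sM.
  rewrite big_split /= -mulr_suml DT.
  by have := gap s; have := lo s sM; rewrite mulr2n; lra.
have -> : e = 2 * eta + 2 * (eta * T).
  by rewrite /eta; field; rewrite gt_eqF // addr_gt0 // mulr_gt0.
have eT : 0 <= eta * T by rewrite mulr_ge0 // ltW.
rewrite ler_norml; apply/andP; split; lra.
Qed.

(* By Markov's inequality for s^k, letting k tend to infinity, since m k <= M^k. *)
Lemma moment_concentrated (mu : probability R R) :
  mu [set s | s < 0] = 0%E ->
  (forall k, mu.-integrable setT (fun s : R => (s ^+ k)%:E) /\
    Rintegral mu setT (fun s : R => s ^+ k) = m k) ->
  mu (~` `[0, M + 1]) = 0%E.
Proof.
move=> mu0 muk.
have mneg : measurable [set s : R | s < 0].
  by rewrite -set_itvNyo; exact: measurable_itv.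
have mD0 : measurable (~` [set s : R | s < 0]) by exact: measurableC.
have muD0 : mu (~` ~` [set s : R | s < 0]) = 0%E by rewrite setCK.
set A := [set s : R | M + 1 < s].
have mA : measurable A by rewrite /A -set_itvoy; exact: measurable_itv.
have muA : mu A = 0%E.
  have finA : mu A \is a fin_num by exact: fin_num_measure.
  rewrite -[LHS]fineK //; congr EFin; apply/le_anti; rewrite fine_ge0 // andbT.
  have bound k : fine (mu A) <= (M / (M + 1)) ^+ k.
    have [ik ek] := muk k.
    have iA : mu.-integrable setT (EFin \o (\1_A : R -> R)) by exact: integrable_indic.
    have eA : Rintegral mu setT (\1_A : R -> R) = fine (mu A).
      by rewrite /Rintegral integral_indic // setIT.
    have M1 : 0 < M + 1 by rewrite ltr_wpDl // ltW.
    rewrite expr_div_n ler_pdivlMr ?exprn_gt0 // mulrC -eA -RintegralZl //.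
    apply: (@le_trans _ _ (m k)); last by case/andP: (moment_le k).
    rewrite -ek; apply: (le_Rintegral_concentrated mD0 muD0) => //.
      exact: integrableZl iA.
    move=> s /= /negP; rewrite -leNgt => s0.
    have [|] := boolP (s \in A); rewrite ?mulr0 ?exprn_ge0 // => /set_mem /= sM.
    by rewrite mulr1 lerXn2r ?nnegrE // ltW.
  have cv : (M / (M + 1)) ^+ k @[k --> \oo] --> (0 : R).
    apply: cvg_expr; rewrite ger0_norm ?divr_ge0 ?addr_ge0 ?ltW //.
    by rewrite ltr_pdivrMr ?mul1r ?ltrDl // ltr_wpDl // ltW.
  rewrite -(cvg_lim _ cv) //; apply: limr_ge; first exact: cvgP cv.
  exact: nearW.
apply/negligibleP; first by apply: measurableC; exact: measurable_itv.
apply: (@negligibleS _ _ _ _ ([set s | s < 0] `|` A)).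
  move=> s /= /negP; rewrite in_itv /= negb_and -!ltNge => /orP[s0|sM]; by [left|right].
by apply: negligibleU; exact/negligibleP.
Qed.

(** A polynomial q uniformly close to f on [0, M + 1] has the same mean under mu and under every
    average matching enough moments. Only the moments of mu enter, so the integral of f is the same
    for all solutions of the moment problem. *)
Lemma average_approx (mu : probability R R) (f : R -> R) :
  mu [set s | s < 0] = 0%E ->
  (forall k, mu.-integrable setT (fun s : R => (s ^+ k)%:E) /\
    Rintegral mu setT (fun s : R => s ^+ k) = m k) ->
  measurable_fun setT f -> continuous (fun s : R => f (Num.max s 0)) ->
  forall e, 0 < e -> exists K, forall N (lam : 'I_N -> R),
    average_match M m K lam -> `|Rintegral mu setT f - average lam f| <= e.
Proof.
move=> mu0 muk mf cf e e0.
have muD := moment_concentrated mu0 muk.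
have M1 : 0 < M + 1 by rewrite ltr_wpDl // ltW.
have mD : measurable (`[0, M + 1] : set R) by exact: measurable_itv.
have e20 : 0 < e / 2 by rewrite divr_gt0.
have [q qP] := weierstrass M1 cf e20.
have q_int (p : {poly R}) : mu.-integrable setT (EFin \o horner p) /\
    Rintegral mu setT (horner p) = poly_mean p.
  have ep : horner p = fun s => \sum_(i < size p) p`_i * s ^+ i.
    by apply/funext => s; rewrite horner_coef.
  have [i3 e3] := Rintegral_linear (fun i : 'I_(size p) => p`_i)
    (fun i : 'I_(size p) => (muk i).1).
  rewrite ep; split=> //; rewrite e3; apply: eq_bigr => i _; congr (_ * _).
  exact: (muk i).2.
have fE s : 0 <= s -> f (Num.max s 0) = f s by move=> s0; rewrite max_l.
have cnf : continuous (fun s : R => `|f (Num.max s 0)|).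
  by move=> s; apply: cvg_norm; exact: cf.
have [c _ cP] := EVT_max (ltW M1) (continuous_subspaceT cnf).
have f_int : mu.-integrable setT (EFin \o f).
  apply: (integrable_concentrated mD muD (B := `|f (Num.max c 0)|)) => // s sD.
  have s0 : 0 <= s by move: sD; rewrite /= in_itv => /andP[].
  by rewrite -(fE s s0); apply: cP.
have near s : 0 <= s <= M + 1 -> q.[s] - e / 2 <= f s <= q.[s] + e / 2.
  move=> s01; have := qP s s01; rewrite fE; last by case/andP: s01.
  by rewrite ler_norml => /andP[? ?]; apply/andP; split; lra.
have qcE (p : {poly R}) x s : (1 *: p + x%:P).[s] = p.[s] + x.
  by rewrite hornerD hornerC scale1r.
have qcM (p : {poly R}) x : poly_mean (1 *: p + x%:P) = poly_mean p + x.
  by rewrite poly_meanP poly_meanC mul1r.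
exists (size q) => N lam lamP; have [N0 lamM _] := lamP.
have size_qc x : (size (1 *: q + x%:P)%R <= (size q).+1)%N.
  rewrite scale1r (leq_trans (size_polyD _ _)) // geq_max leqnSn.
  by rewrite (leq_trans (size_polyC_leq1 _)).
have I1 : Rintegral mu setT f <= poly_mean q + e / 2.
  rewrite -qcM -(q_int _).2; apply: (le_Rintegral_concentrated mD muD) => //.
    exact: (q_int _).1.
  by move=> s; rewrite /= in_itv /= qcE => /near /andP[].
have I2 : poly_mean q + - (e / 2) <= Rintegral mu setT f.
  rewrite -qcM -(q_int _).2; apply: (le_Rintegral_concentrated mD muD) => //.
    exact: (q_int _).1.
  by move=> s; rewrite /= in_itv /= qcE => /near /andP[].
have wide s : 0 <= s <= M -> 0 <= s <= M + 1.
  by move=> /andP[-> sM] /=; rewrite (le_trans sM) // lerDl.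
have A1 : average lam f <= poly_mean q + e / 2.
  rewrite -qcM (poly_meanE lamP) //; apply: average_le lamM _ => s /wide sM.
  by rewrite qcE; case/andP: (near s sM).
have A2 : poly_mean q + - (e / 2) <= average lam f.
  rewrite -qcM (poly_meanE lamP) //; apply: average_le lamM _ => s /wide sM.
  by rewrite qcE; case/andP: (near s sM).
clear - I1 I2 A1 A2; rewrite ler_norml; apply/andP; split; lra.
Qed.

End Hausdorff.

(** * Singular values and convexity of the Schatten norms *)

Section SingularValues.
Variable R : realType.
Local Notation C := R[i].

Lemma trmxC_mul m n q (A : 'M[C]_(m, n)) (B : 'M[C]_(n, q)) :
  (A *m B)^t* = B^t* *m A^t*.
Proof. by rewrite trmx_mul map_mxM. Qed.

Lemma trmxC_sub m n (A B : 'M[C]_(m, n)) : (A - B)^t* = A^t* - B^t*.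
Proof. by apply/matrixP => i j; rewrite !mxE rmorphB. Qed.

Lemma Re_le_norm (z : C) : (complex.Re z)%:C%C <= `|z|.
Proof.
rewrite normc_def lecR (le_trans (ler_norm _)) // -sqrtr_sqr.
by rewrite ler_wsqrtr // lerDl sqr_ge0.
Qed.

Lemma mulmx_trmxC_diag m n (A : 'M[C]_(m, n)) i :
  (A^t* *m A) i i = \sum_k `|A k i| ^+ 2.
Proof.
rewrite mxE; apply: eq_bigr => k _.
by rewrite !mxE normCK mulrC.
Qed.

Lemma mulmx_diag_trmxC m n (A : 'M[C]_(m, n)) i :
  (A *m A^t*) i i = \sum_k `|A i k| ^+ 2.
Proof. by rewrite mxE; apply: eq_bigr => k _; rewrite !mxE normCK. Qed.

(** The columns in P are orthonormal and the others vanish, so a null singular value has a zero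
    column. *)
Definition partial_isometry N (E : 'M[C]_N) (P : pred 'I_N) :=
  E^t* *m E = diag_mx (\row_i (P i)%:R).

(** F F^* is an orthogonal projection Q', and E^* E minus the Gram matrix of the rows of E^* F
    equals T^* T for T = (1 - Q') E, whose diagonal is nonnegative. *)
Lemma bessel_partial_isometry N (E F : 'M[C]_N) P Q i :
  partial_isometry E P -> partial_isometry F Q ->
  \sum_k `|(E^t* *m F) i k| ^+ 2 <= 1.
Proof.
move=> EP FQ.
have F0 k l : ~~ Q l -> F k l = 0.
  move=> Ql; have := mulmx_trmxC_diag F l; rewrite FQ !mxE eqxx (negbTE Ql) mul0rn => /esym/eqP.
  rewrite psumr_eq0 => [/allP /(_ k (mem_index_enum _))|j _]; last exact: exprn_ge0.
  by rewrite /= expf_eq0 /= normr_eq0 => /eqP.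
have FF : F *m F^t* *m F = F.
  rewrite -mulmxA FQ; apply/matrixP => k l; rewrite mul_mx_diag !mxE.
  by have [Ql|/F0 ->] := boolP (Q l); rewrite ?mulr1 ?mul0r.
set Q' := F *m F^t* in FF.
have Qs : Q'^t* = Q' by rewrite /Q' trmxC_mul trmxCK.
have QQ : Q' *m Q' = Q' by rewrite {2}/Q' mulmxA FF.
pose T := E - Q' *m E.
have TT : T^t* *m T = E^t* *m E - (E^t* *m F) *m (E^t* *m F)^t*.
  rewrite /T trmxC_sub trmxC_mul Qs mulmxBl !mulmxBr.
  rewrite (mulmxA (E^t* *m Q') Q' E) -(mulmxA (E^t*) Q' Q') QQ subrr subr0.
  by rewrite trmxC_mul trmxCK /Q' !mulmxA.
have : 0 <= (T^t* *m T) i i.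
  by rewrite mulmx_trmxC_diag sumr_ge0 // => k _; exact: exprn_ge0.
have PE : (E^t* *m E) i i = (P i)%:R by rewrite EP !mxE eqxx.
rewrite TT mxE [X in _ + X]mxE PE mulmx_diag_trmxC subr_ge0 => h.
by apply: le_trans h _; case: (P i).
Qed.

(** V diagonalises A^* A, so the columns of Y = A V^* are orthogonal with lengths s i. E normalises
    the nonzero ones; the convention 0^-1 = 0 keeps the others zero. *)
Lemma svd N (A : 'M[C]_N) : exists (E V : 'M[C]_N) (s : 'I_N -> R),
  [/\ partial_isometry E (fun i => s i != 0), V \is unitarymx,
      forall i, 0 <= s i,
      A = E *m diag_mx (\row_i (s i)%:C%C) *m V &
      A^t* *m A = V^t* *m diag_mx (\row_i (s i ^+ 2)%:C%C) *m V].
Proof.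
set H := A^t* *m A.
have Hn : H \is normalmx by apply/normalmxP; rewrite /H trmxC_mul trmxCK.
have Vu := spectral_unitarymx H; set V := spectralmx H in Vu *.
have VV : V *m V^t* = 1%:M by apply/unitarymxP.
have VV' : V^t* *m V = 1%:M.
  by rewrite -[X in _ *m X]trmxCK; apply/unitarymxP; rewrite trmxC_unitary.
have HE : H = V^t* *m diag_mx (spectral_diag H) *m V.
  by rewrite -(invmx_unitary Vu); exact/orthomx_spectralP.
set sp := spectral_diag H in HE *.
pose Y := A *m V^t*.
have YY : Y^t* *m Y = diag_mx sp.
  rewrite /Y trmxC_mul trmxCK mulmxA -(mulmxA V) -/H HE.
  by rewrite !mulmxA VV mul1mx -mulmxA VV mulmx1.
have AY : A = Y *m V by rewrite /Y -mulmxA VV' mulmx1.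
clearbody Y.
have sp_ge0 i : 0 <= sp 0 i.
  have := mulmx_trmxC_diag Y i; rewrite YY !mxE eqxx mulr1n => ->.
  by rewrite sumr_ge0 // => k _; exact: exprn_ge0.
pose s i := Num.sqrt (complex.Re (sp 0 i)).
have s2 i : (s i ^+ 2)%:C%C = sp 0 i.
  rewrite sqr_sqrtr; first by rewrite RRe_real // ger0_real.
  by rewrite -ler0c RRe_real // ger0_real.
have spE : diag_mx sp = diag_mx (\row_i (s i ^+ 2)%:C%C).
  by congr diag_mx; apply/rowP => i; rewrite mxE s2.
have Y0 k i : s i = 0 -> Y k i = 0.
  move=> si; have : \sum_k `|Y k i| ^+ 2 = 0.
    by rewrite -mulmx_trmxC_diag YY !mxE eqxx mulr1n -s2 si expr0n.
  move=> /psumr_eq0P => H0.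
  have /eqP := H0 (fun j _ => exprn_ge0 2 (normr_ge0 (Y j i))) k isT.
  by rewrite expf_eq0 normr_eq0 => /eqP.
exists (Y *m diag_mx (\row_i ((s i)^-1)%:C%C)), V, s; split.
- rewrite /partial_isometry trmxC_mul mulmxA -(mulmxA _ (Y^t*)) YY spE.
  rewrite tr_diag_mx map_diag_mx !mulmx_diag; congr diag_mx; apply/rowP => i.
  rewrite !mxE /= conj_Creal ?complex_real // -!rmorphM.
  have [->|si] := eqVneq (s i) 0; first by rewrite invr0 mul0r mul0r.
  by rewrite expr2 !mulrA mulVf // mul1r divff.
- exact: Vu.
- by move=> i; exact: sqrtr_ge0.
- rewrite -(mulmxA Y) mulmx_diag; rewrite {1}AY.
  congr (_ *m V); apply/matrixP => k i; rewrite mul_mx_diag !mxE -rmorphM.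
  by have [/Y0 ->|si] := eqVneq (s i) 0; rewrite ?mul0r // mulVf // mulr1.
- by rewrite HE spE.
Qed.

(** Each sZ i is a diagonal entry of EZ^* Z VZ^* , hence a combination of the singular values of the
    X j, with weights dominated by doubly substochastic matrices. Young's inequality then replaces
    the duality between L_p and its dual. *)
Lemma schatten_convex N m (Z : 'M[C]_N) (X : 'I_m -> 'M[C]_N) (c : 'I_m -> R) (K p : R)
    (EZ VZ : 'M[C]_N) (sZ : 'I_N -> R) (F W : 'I_m -> 'M[C]_N) (s : 'I_m -> 'I_N -> R) :
  1 <= p -> 0 < K -> (forall j, 0 <= c j) -> \sum_j c j <= K ->
  Z = \sum_j (c j)%:C%C *: X j ->
  partial_isometry EZ (fun i => sZ i != 0) -> VZ \is unitarymx -> (forall i, 0 <= sZ i) ->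
  Z = EZ *m diag_mx (\row_i (sZ i)%:C%C) *m VZ ->
  (forall j, partial_isometry (F j) (fun i => s j i != 0)) ->
  (forall j, W j \is unitarymx) -> (forall j i, 0 <= s j i) ->
  (forall j, X j = F j *m diag_mx (\row_i (s j i)%:C%C) *m W j) ->
  \sum_i sZ i `^ p <= K `^ p * \sum_j (c j / K) * \sum_i s j i `^ p.
Proof.
move=> p1 K0 c0 cK ZX EZP VZu sZ0 ZE FP Wu s0 XE.
have p0 : 0 < p by exact: lt_le_trans p1.
have VV : VZ *m VZ^t* = 1%:M by apply/unitarymxP.
have WW j : W j *m (W j)^t* = 1%:M by apply/unitarymxP.
pose g j := EZ^t* *m F j; pose u j := W j *m VZ^t*.
(* The mean of squares dominates |g| |u|; Bessel's inequality for g, in both directions, and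
   unitarity of u bound all row and column sums of [D] by 1. *)
pose D j i k := complex.Re ((`|g j i k| ^+ 2 + `|u j k i| ^+ 2) / 2).
have ReD j i k : (D j i k)%:C%C = (`|g j i k| ^+ 2 + `|u j k i| ^+ 2) / 2.
  by rewrite RRe_real // ger0_real // divr_ge0 // addr_ge0 // exprn_ge0.
have D0 j i k : 0 <= D j i k.
  by rewrite -ler0c ReD divr_ge0 // addr_ge0 // exprn_ge0.
have u_row j k : \sum_i `|u j k i| ^+ 2 = 1.
  have : (u j *m (u j)^t*) k k = 1.
    rewrite /u trmxC_mul trmxCK mulmxA -(mulmxA (W j)).
    have -> : VZ^t* *m VZ = 1%:M.
      by rewrite -[X in _ *m X]trmxCK; apply/unitarymxP; rewrite trmxC_unitary.
    by rewrite mulmx1 WW mxE eqxx.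
  by rewrite mulmx_diag_trmxC.
have u_col j i : \sum_k `|u j k i| ^+ 2 = 1.
  rewrite -mulmx_trmxC_diag /u trmxC_mul trmxCK mulmxA -(mulmxA VZ).
  have -> : (W j)^t* *m W j = 1%:M.
    by rewrite -[X in _ *m X]trmxCK; apply/unitarymxP; rewrite trmxC_unitary.
  by rewrite mulmx1 VV mxE eqxx.
have D_row j i : \sum_k D j i k <= 1.
  rewrite -lecR rmorph_sum /=; under eq_bigr => k _ do rewrite ReD.
  rewrite -mulr_suml big_split /= u_col ler_pdivrMr // mul1r -[2]/(1 + 1) lerD2r.
  exact: bessel_partial_isometry EZP (FP j).
have D_col j k : \sum_i D j i k <= 1.
  rewrite -lecR rmorph_sum /=; under eq_bigr => i _ do rewrite ReD.
  rewrite -mulr_suml big_split /= u_row ler_pdivrMr // mul1r -[2]/(1 + 1) lerD2r.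
  have := bessel_partial_isometry k (FP j) EZP; apply: le_trans.
  apply: ler_sum => i _; rewrite /g -[X in X *m EZ]trmxCK -[X in _ *m X]trmxCK.
  by rewrite -trmxC_mul !mxE norm_conjC trmxCK.
have sZE i : (sZ i)%:C%C = \sum_j (c j)%:C%C * \sum_k g j i k * (s j k)%:C%C * u j k i.
  have e : (EZ^t* *m Z *m VZ^t*) i i = (sZ i)%:C%C.
    rewrite ZE !mulmxA EZP -mulmxA VV mulmx1 mulmx_diag !mxE eqxx mulr1n.
    by have [->|_] := eqVneq (sZ i) 0; rewrite ?mul0r ?mul1r.
  rewrite -e ZX mulmx_sumr mulmx_suml summxE; apply: eq_bigr => j _.
  rewrite -scalemxAr -scalemxAl mxE; congr (_ * _).
  rewrite XE !mulmxA -/(g j) -(mulmxA _ (W j)) -/(u j) mxE.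
  by apply: eq_bigr => k _; rewrite mul_mx_diag mxE; congr (_ * _ * _); rewrite mxE.
have step j i : complex.Re (\sum_k g j i k * (s j k)%:C%C * u j k i) <= \sum_k D j i k * s j k.
  rewrite raddf_sum; apply: ler_sum => k _.
  rewrite -lecR rmorphM /= ReD.
  apply: le_trans (Re_le_norm _) _.
  rewrite !normrM (ger0_norm (_ : 0 <= (s j k)%:C%C)) ?ler0c //.
  rewrite mulrAC ler_wpM2r ?ler0c // ler_pdivlMr //.
  rewrite -subr_ge0 (_ : _ - _ = (`|g j i k| - `|u j k i|) ^+ 2); last by ring.
  by rewrite -realEsqr realB // normr_real.
have sZpos i : sZ i `^ p = sZ i `^ (p - 1) * sZ i.
  by rewrite mulrC mulr_powRB1.
have sZre i : sZ i <= \sum_j c j * \sum_k D j i k * s j k.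
  have -> : sZ i = complex.Re (sZ i)%:C%C by [].
  rewrite sZE raddf_sum; apply: ler_sum => j _.
  rewrite [X in X <= _](_ : _ = c j * complex.Re (\sum_k g j i k * (s j k)%:C%C * u j k i)).
    by rewrite ler_wpM2l.
  by case: (\sum_k _) => a b /=; rewrite mul0r subr0.
set S := \sum_i sZ i `^ p.
(* Young is applied to sZ^(p-1) and K s; S reappears with total weight at most 1 - 1/p and is
   absorbed on the left. *)
have main : S <= \sum_j (c j / K) * ((1 - p^-1) * S + p^-1 * (K `^ p * \sum_k s j k `^ p)).
  rewrite [X in X <= _](_ : S = \sum_i sZ i `^ (p - 1) * sZ i); last first.
    by apply: eq_bigr => i _; exact: sZpos.
  apply: (@le_trans _ _ (\sum_i \sum_j (c j / K) * \sum_k D j i k *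
      ((1 - p^-1) * sZ i `^ p + p^-1 * (K * s j k) `^ p))).
    apply: ler_sum => i _; apply: le_trans (ler_wpM2l (powR_ge0 _ _) (sZre i)) _.
    rewrite mulr_sumr; apply: ler_sum => j _.
    rewrite mulrCA -[leRHS]mulrA ler_wpM2l // !mulr_sumr; apply: ler_sum => k _.
    have := young_powR p1 (sZ0 i) (mulr_ge0 (ltW K0) (s0 j k)) => yk.
    apply: le_trans (_ : K^-1 * (D j i k * (sZ i `^ (p - 1) * (K * s j k))) <= _); last first.
      by rewrite ler_wpM2l ?invr_ge0 ?(ltW K0) // ler_wpM2l.
    by rewrite le_eqVlt; apply/orP; left; apply/eqP; field; rewrite gt_eqF.
  rewrite exchange_big /=; apply: ler_sum => j _; rewrite -mulr_sumr.
  rewrite ler_wpM2l ?divr_ge0 ?(ltW K0) //.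
  have q1 : 0 <= 1 - p^-1 by rewrite subr_ge0 invf_le1.
  have pi0 : 0 <= p^-1 by rewrite invr_ge0 ltW.
  rewrite [leLHS](_ : _ = \sum_i (\sum_k D j i k) * ((1 - p^-1) * sZ i `^ p) +
      \sum_i \sum_k D j i k * (p^-1 * (K * s j k) `^ p)); last first.
    rewrite -big_split; apply: eq_bigr => i _; rewrite mulr_suml -big_split /=.
    by apply: eq_bigr => k _; rewrite -mulrDr.
  rewrite lerD //.
    rewrite -/S mulr_sumr; apply: ler_sum => i _; rewrite -[leRHS]mul1r.
    by rewrite ler_wpM2r // mulr_ge0 // powR_ge0.
  rewrite exchange_big /= !mulr_sumr; apply: ler_sum => k _; rewrite -mulr_suml.
  rewrite powRM ?(ltW K0) // -[leRHS]mul1r ler_wpM2r // !mulr_ge0 ?powR_ge0 //.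
have S0 : 0 <= S by rewrite sumr_ge0 // => i _; exact: powR_ge0.
set T := _ * _; have w1 : \sum_j c j / K <= 1 by rewrite -mulr_suml ler_pdivrMr ?mul1r.
have mainE : \sum_j (c j / K) * ((1 - p^-1) * S + p^-1 * (K `^ p * \sum_k s j k `^ p)) =
    (\sum_j c j / K) * ((1 - p^-1) * S) + p^-1 * T.
  rewrite /T mulr_suml !mulr_sumr -big_split; apply: eq_bigr => j _ /=; ring.
have q1 : 0 <= 1 - p^-1 by rewrite subr_ge0 invf_le1.
have := ler_wpM2r (mulr_ge0 q1 S0) w1; rewrite mul1r => wS.
have : p^-1 * S <= p^-1 * T.
  by move: main; rewrite mainE => main; move: wS main; clear; lra.
by rewrite ler_pM2l // invr_gt0.
Qed.

Lemma svd_power_trace N (A V : 'M[C]_N) (s : 'I_N -> R) k :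
  V \is unitarymx -> A^t* *m A = V^t* *m diag_mx (\row_i (s i ^+ 2)%:C%C) *m V ->
  \tr (iter k (mulmx (A^t* *m A)) 1%:M) = (\sum_i (s i ^+ 2) ^+ k)%:C%C.
Proof.
move=> Vu AE; have VV : V *m V^t* = 1%:M by apply/unitarymxP.
have VV' : V^t* *m V = 1%:M.
  by rewrite -[X in _ *m X]trmxCK; apply/unitarymxP; rewrite trmxC_unitary.
have -> : iter k (mulmx (A^t* *m A)) 1%:M =
    V^t* *m diag_mx (\row_i ((s i ^+ 2) ^+ k)%:C%C) *m V.
  elim: k => [|k IH] /=.
    rewrite (_ : diag_mx _ = 1%:M) ?mulmx1 ?VV' // -diag_const_mx.
    by congr diag_mx; apply/rowP => i; rewrite !mxE expr0.
  rewrite IH AE !mulmxA -(mulmxA _ V) VV mulmx1 -(mulmxA (V^t*)) mulmx_diag.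
  by congr (_ *m diag_mx _ *m _); apply/rowP => i; rewrite !mxE -rmorphM -exprS.
rewrite mxtrace_mulC mulmxA VV mul1mx mxtrace_diag rmorph_sum.
by apply: eq_bigr => i _; rewrite mxE.
Qed.

(** Row i of V is a left eigenvector of H; the eigenvalue equation is read at its entry of largest
    modulus. This bounds the spectra uniformly over all quotients. *)
Lemma eigenvalue_le_colsum N (H V : 'M[C]_N) (l : 'I_N -> R) M :
  V \is unitarymx -> H = V^t* *m diag_mx (\row_i (l i)%:C%C) *m V ->
  (forall j, \sum_k `|H k j| <= M%:C%C) -> forall i, 0 <= l i -> l i <= M.
Proof.
move=> Vu HE HM i l0; have VV : V *m V^t* = 1%:M by apply/unitarymxP.
have VH : V *m H = diag_mx (\row_i (l i)%:C%C) *m V.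
  by rewrite HE !mulmxA VV mul1mx.
have [j jmax] : exists j, forall k, `|V i k| <= `|V i j|.
  case: (@arg_maxP _ R _ i xpredT (fun k => complex.Re `|V i k|) isT) => j _ jmax.
  exists j => k; have h : complex.Re `|V i k| <= complex.Re `|V i j| := jmax k isT.
  by rewrite -lecR !RRe_real ?normr_real in h.
have Vij : 0 < `|V i j|.
  rewrite lt_neqAle normr_ge0 andbT eq_sym; apply/negP => /eqP V0.
  have := congr1 (fun B : 'M[C]_N => B i i) VV; rewrite !mxE eqxx big1 => [/eqP|k _].
    by rewrite eq_sym oner_eq0.
  have := jmax k; rewrite V0 normr_le0 => /eqP ->; exact: mul0r.
rewrite -lecR -(ler_pM2r Vij) -(ger0_norm (_ : 0 <= (l i)%:C%C)) ?ler0c // -normrM.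
have -> : (l i)%:C%C * V i j = (V *m H) i j by rewrite VH mul_diag_mx !mxE.
rewrite mxE; apply: le_trans (ler_norm_sum _ _ _) _.
apply: le_trans (_ : \sum_k `|V i j| * `|H k j| <= _).
  by apply: ler_sum => k _; rewrite normrM ler_wpM2r.
by rewrite -mulr_sumr mulrC ler_wpM2r.
Qed.

End SingularValues.

(** * Matrix models and the L_p norms *)

Section WordInverse.
Variable n : nat.
Implicit Types (w g : word n).

Lemma winvK : involutive (@winv n).
Proof.
move=> w; rewrite /winv map_rev revK -map_comp -[RHS]map_id.
by apply: eq_map => a; exact: linvK.
Qed.

Lemma reduce_mulV w : reduce (w ++ winv w) = [::].
Proof.
elim: w => //= a w IH; rewrite winv_cons catA.
rewrite -[reduce (_ ++ [:: linv a])]reduce_catl IH /=.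
by rewrite !eqxx.
Qed.

Lemma reduce_Vmul w : reduce (winv w ++ w) = [::].
Proof. by rewrite -{2}(winvK w) reduce_mulV. Qed.

Lemma reduce_cat_eq w v g :
  (reduce (w ++ v) == reduce g) = (reduce w == reduce (g ++ winv v)).
Proof.
apply/eqP/eqP => e.
  rewrite -(reduce_catl g) -e reduce_catl -catA -reduce_catr reduce_mulV.
  by rewrite cats0.
by rewrite -reduce_catl e reduce_catl -catA -reduce_catr reduce_Vmul cats0.
Qed.

End WordInverse.

(** * Coefficients and word lengths of products *)

Section Coefficients.
Variables (n : nat) (R : realType).
Local Notation P := (fpoly n R).
Local Notation C := R[i].
Implicit Types (x y f : P) (g w : word n).

Lemma conjcE (z : C) : conjc z = Num.conj z.
Proof. by []. Qed.

Lemma coef_sumE x g : coef x g = \sum_(e <- x) (reduce e.1 == reduce g)%:R * e.2.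
Proof.
rewrite /coef big_mkcond; apply: eq_bigr => e _.
by case: eqP => _; rewrite ?mul1r ?mul0r.
Qed.

Lemma coef_mul x f g : coef (pmul x f) g = \sum_(b <- f) coef x (g ++ winv b.1) * b.2.
Proof.
rewrite coef_sumE /pmul big_allpairs_dep /= exchange_big /=; apply: eq_bigr => b _.
rewrite coef_sumE mulr_suml; apply: eq_bigr => a _ /=.
by rewrite /wmul reduce_idem reduce_cat_eq mulrA.
Qed.

Lemma coef_mul_sum x f g :
  coef (pmul x f) g = \sum_(i < size x) coef (pmul [:: tnth (in_tuple x) i] f) g.
Proof.
rewrite coef_sumE /pmul big_allpairs_dep /= big_tnth; apply: eq_bigr => i _.
by rewrite /= cats0 coef_sumE big_map.
Qed.

Definition max_size x := \max_(e <- x) size e.1.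

Definition word_bound s x := forall e, e \in x -> (size e.1 <= s)%N.

Lemma word_bound_max x : word_bound (max_size x) x.
Proof. by move=> e ex; rewrite /max_size (big_rem e ex) /= leq_maxl. Qed.

Lemma word_bound_le s t x : (s <= t)%N -> word_bound s x -> word_bound t x.
Proof. by move=> st xs e /xs es; exact: leq_trans st. Qed.

Lemma word_bound_mul s t x y : word_bound s x -> word_bound t y ->
  word_bound (s + t) (pmul x y).
Proof.
move=> xs yt e /allpairsP[[a b] /= [ax bx ->]] /=.
rewrite /wmul (leq_trans (size_reduce _)) // size_cat.
by rewrite leq_add ?xs ?yt.
Qed.

Lemma word_bound_adj s x : word_bound s x -> word_bound s (padj x).
Proof. by move=> xs e /mapP[a ax ->] /=; rewrite size_winv xs. Qed.

Lemma word_bound_exp s x k : word_bound s x -> word_bound (k * s) (pexp x k).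
Proof.
move=> xs; elim: k => [|k IH] /=.
  by move=> e; rewrite inE => /eqP ->.
by rewrite mulSn; exact: word_bound_mul.
Qed.

Lemma coef_neq0_size x g : coef x g != 0 -> (wlen g <= max_size x)%N.
Proof.
rewrite leqNgt; apply: contra => gx; rewrite coef_sumE big_seq big1 // => e ex.
case: eqP => [eg|]; last by rewrite mul0r.
move: gx; rewrite /wlen -eg ltnNge (leq_trans (size_reduce _)) //.
exact: word_bound_max ex.
Qed.

End Coefficients.

Definition quotient_order n K := #|{: {perm {bseq K of letter n}}}|.

(* The image of the polynomials in the regular representation of a finite quotient of F_n;
   the normalised matrix trace computes tau on words of length at most K. *)
Section FiniteQuotient.
Variables (n : nat) (R : realType) (K : nat).
Local Notation P := (fpoly n R).
Local Notation C := R[i].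
Local Notation gT := {perm {bseq K of letter n}}.
Local Notation N := (quotient_order n K).
Implicit Types (x y : P) (w : word n).

(** Translation on the right, because [wperm] reverses products; the matrices are then
    multiplicative in the word. *)
Definition regular w : 'M[C]_N :=
  \matrix_(i, j) (enum_val i == enum_val j * wperm K w)%g%:R.

Lemma regular_cat w v : regular w *m regular v = regular (w ++ v).
Proof.
apply/matrixP => i j; rewrite !mxE.
rewrite (bigD1 (enum_rank (enum_val j * wperm K v)%g)) //= big1 => [|k kj].
  by rewrite !mxE enum_rankK eqxx mulr1 addr0 wperm_cat mulgA.
rewrite !mxE; have -> : (enum_val k == (enum_val j * wperm K v)%g) = false.
  by apply: contraNF kj => /eqP <-; rewrite enum_valK.
by rewrite mulr0.
Qed.

Lemma regular_reduce w : regular (reduce w) = regular w.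
Proof. by rewrite /regular wperm_reduce. Qed.

Lemma regular_nil : regular [::] = 1%:M.
Proof. by apply/matrixP => i j; rewrite !mxE /= mulg1 (inj_eq enum_val_inj). Qed.

Lemma regular_winv w : regular (winv w) = (regular w)^t*.
Proof.
apply/matrixP => i j; rewrite !mxE /= rmorph_nat wperm_winv.
by rewrite eq_sym (can2_eq (mulgKV _) (mulgK _)).
Qed.

(** A translation of a group has no fixed point unless it is trivial, and up to length K the
    quotient detects triviality. *)
Lemma regular_trace w : (size w <= K)%N ->
  \tr (regular w) = (reduce w == [::])%:R * N%:R.
Proof.
move=> wK; have -> : (reduce w == [::]) = (wperm K w == 1%g).
  apply/eqP/eqP => [e|/(wperm_eq1 wK)//].
  by rewrite -wperm_reduce e.
rewrite /mxtrace; under eq_bigr => i _.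
  rewrite mxE -{1}[enum_val i]mulg1 (inj_eq (mulgI _)) eq_sym.
  over.
by rewrite sumr_const card_ord mulr_natr.
Qed.

Lemma regular_colsum w j : \sum_k `|regular w k j| = 1.
Proof.
rewrite (bigD1 (enum_rank (enum_val j * wperm K w)%g)) //= big1 => [|k kj].
  by rewrite !mxE enum_rankK eqxx normr1 addr0.
rewrite !mxE (_ : _ == _ = false) ?normr0 //; apply: contraNF kj => /eqP <-.
by rewrite enum_valK.
Qed.

Definition rep x : 'M[C]_N := \sum_(e <- x) e.2 *: regular e.1.

Lemma rep1 w (u : C) : rep [:: (w, u)] = u *: regular w.
Proof. by rewrite /rep big_seq1. Qed.

Lemma rep_mul x y : rep (pmul x y) = rep x *m rep y.
Proof.
rewrite /rep /pmul big_allpairs_dep mulmx_suml; apply: eq_bigr => a _.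
rewrite mulmx_sumr; apply: eq_bigr => b _ /=.
by rewrite -scalemxAl -scalemxAr scalerA regular_reduce regular_cat.
Qed.

Lemma rep_adj x : rep (padj x) = (rep x)^t*.
Proof.
rewrite /rep big_map raddf_sum map_mx_sum; apply: eq_bigr => a _ /=.
by rewrite regular_winv linearZ map_mxZ.
Qed.

Lemma rep_one : rep (@pone n R) = 1%:M.
Proof. by rewrite /rep big_seq1 scale1r regular_nil. Qed.

Lemma rep_exp x k : rep (pexp x k) = iter k (mulmx (rep x)) 1%:M.
Proof. by elim: k => [|k IH]; [exact: rep_one|rewrite /= rep_mul IH]. Qed.

Lemma card_quotient_gt0 : (0 < N)%N.
Proof. by apply/card_gt0P; exists 1%g. Qed.

Lemma rep_trace x : word_bound K x -> \tr (rep x) = N%:R * tau x.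
Proof.
move=> xK; rewrite /rep raddf_sum /tau coef_sumE mulr_sumr big_seq [RHS]big_seq.
apply: eq_bigr => e ex; rewrite /= mxtraceZ regular_trace ?xK //=.
by rewrite mulrC -mulrA mulrCA.
Qed.

(** Grouping terms by reduced word shows that [rep] depends only on the coefficients; a free S
    allows one list to serve several polynomials. *)
Lemma rep_coef (S : seq (word n)) x : uniq S -> (forall g, g \in S -> reduce g = g) ->
  (forall e, e \in x -> reduce e.1 \in S) ->
  rep x = \sum_(g <- S) coef x g *: regular g.
Proof.
move=> uS rS xS.
under [RHS]eq_bigr => g _ do rewrite coef_sumE scaler_suml.
rewrite exchange_big /=; rewrite /rep big_seq [RHS]big_seq; apply: eq_bigr => e ex.
rewrite (bigD1_seq (reduce e.1)) ?xS //= reduce_idem eqxx mul1r regular_reduce.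
rewrite big_seq_cond big1 ?addr0 // => g /andP[gS ge].
by rewrite (rS _ gS) eq_sym (negbTE ge) mul0r scale0r.
Qed.

Definition l1_norm x : R := \sum_(e <- x) complex.Re `|e.2|.

Lemma rep_colsum x j : \sum_k `|rep x k j| <= (l1_norm x)%:C%C.
Proof.
rewrite /l1_norm rmorph_sum /=.
apply: le_trans (_ : \sum_k \sum_(e <- x) `|e.2| * `|regular e.1 k j| <= _).
  apply: ler_sum => k _; rewrite /rep summxE; apply: le_trans (ler_norm_sum _ _ _) _.
  by apply: ler_sum => e _; rewrite mxE normrM.
rewrite exchange_big /=; apply: ler_sum => e _.
by rewrite -mulr_sumr regular_colsum mulr1; exact: lexx.
Qed.

End FiniteQuotient.

(** * L_p norms as limits of normalised traces *)

Section LpNorm.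
Variables (n : nat) (R : realType).
Local Notation P := (fpoly n R).
Local Notation C := R[i].
Implicit Types (x y f : P) (g w : word n).

Definition moment x k : R := complex.Re (tau (pexp (pmul (padj x) x) k)).

(** An upper bound, common to all quotients, for the spectrum of x^* x; the summand 1 makes it
    positive even for x = 0. *)
Definition spec_bound x : R := l1_norm (pmul (padj x) x) + 1.

Lemma l1_norm_ge0 x : 0 <= l1_norm x.
Proof. by apply: sumr_ge0 => e _; rewrite -ler0c RRe_real ?normr_real. Qed.

Lemma spec_bound_gt0 x : 0 < spec_bound x.
Proof. by rewrite ltr_wpDl // l1_norm_ge0. Qed.

(** The words of the k-th power of x^* x have length at most 2 k [max_size x], so in the quotient of
    radius K the normalised trace is exact. *)
Lemma tau_moment x k K (V : 'M[C]_(quotient_order n K)) s :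
  (k * (max_size x + max_size x) <= K)%N -> V \is unitarymx ->
  (rep K x)^t* *m rep K x = V^t* *m diag_mx (\row_i (s i ^+ 2)%:C%C) *m V ->
  tau (pexp (pmul (padj x) x) k) = (average (fun i => s i ^+ 2) (fun r => r ^+ k))%:C%C.
Proof.
move=> kK Vu AE; set N := quotient_order n K in V s Vu AE *.
have N0 : N%:R != 0 :> C by rewrite pnatr_eq0 -lt0n card_quotient_gt0.
have := @rep_trace n R K (pexp (pmul (padj x) x) k); rewrite -/N.
rewrite rep_exp rep_mul rep_adj (svd_power_trace k Vu AE) => e.
apply: (mulfI N0); rewrite -e.
  rewrite /average rmorphM fmorphV /= rmorph_nat mulrCA divff // mulr1.
  by [].
apply: word_bound_le kK _; apply: word_bound_exp; apply: word_bound_mul.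
  exact/word_bound_adj/word_bound_max.
exact: word_bound_max.
Qed.

Lemma rep_average_match x L K (V : 'M[C]_(quotient_order n K)) s :
  (L * (max_size x + max_size x) <= K)%N -> V \is unitarymx ->
  (rep K x)^t* *m rep K x = V^t* *m diag_mx (\row_i (s i ^+ 2)%:C%C) *m V ->
  average_match (spec_bound x) (moment x) L (fun i => s i ^+ 2).
Proof.
move=> LK Vu AE; split=> [|i|k kL].
- exact: card_quotient_gt0.
- rewrite sqr_ge0 /=; apply: (eigenvalue_le_colsum Vu AE) => [j|]; last exact: sqr_ge0.
  rewrite -rep_adj -rep_mul; apply: le_trans (rep_colsum _ j) _.
  by rewrite lecR lerDl.
- rewrite /moment (tau_moment _ Vu AE) //.
  by apply: leq_trans LK; rewrite leq_mul2r kL orbT.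
Qed.

Lemma moment_match x L : exists N (lam : 'I_N -> R),
  average_match (spec_bound x) (moment x) L lam.
Proof.
have [E [V [s [_ Vu _ _ AE]]]] := svd (rep (L * (max_size x + max_size x)) x).
by exists _, (fun i => s i ^+ 2); exact: (rep_average_match _ Vu AE).
Qed.

Lemma momentC x k : (moment x k)%:C%C = tau (pexp (pmul (padj x) x) k).
Proof.
have [E [V [s [_ Vu _ _ AE]]]] := svd (rep (k * (max_size x + max_size x)) x).
by rewrite /moment (tau_moment _ Vu AE).
Qed.

Lemma sqr_powR_half (s p : R) : 0 <= s -> (s ^+ 2) `^ (p / 2) = s `^ p.
Proof. by move=> s0; rewrite -powR_mulrn // -powRrM mulrC divfK. Qed.

(** The moment problem supplies a distribution, so [xget] does not fall to its default 0; whichever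
    measure it picks, r is the limit of the normalised traces of |rep x|^p. *)
Lemma Lpnorm_fin_approx (p : R) x : 0 < p -> exists r : R,
  [/\ 0 <= r, Lpnorm_fin p x = r `^ p^-1 & forall e, 0 < e -> exists L,
    forall K, (L <= K)%N -> forall (V : 'M[C]_(quotient_order n K)) s,
    V \is unitarymx -> (forall i, 0 <= s i) ->
    (rep K x)^t* *m rep K x = V^t* *m diag_mx (\row_i (s i ^+ 2)%:C%C) *m V ->
    `|r - (\sum_i s i `^ p) / (quotient_order n K)%:R| <= e].
Proof.
move=> p0; set A := [set r : R | exists mu : probability R R,
    is_distribution (pmul (padj x) x) mu /\
    r = powR (Rintegral mu setT (fun s : R => powR s (p / 2))) (p^-1)].
have [mu [mu0 _ muk]] := hausdorff_moment (spec_bound_gt0 x) (moment_match x).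
have : A (xget 0 A).
  apply: (@xgetPex _ 0 A); exists ((Rintegral mu setT (fun s : R => powR s (p / 2))) `^ p^-1).
  exists mu; split=> //; split=> // k; have [ik ek] := muk k.
  by split=> //; rewrite ek momentC.
case=> nu [[nu0 nuk] rE].
exists (Rintegral nu setT (fun s : R => powR s (p / 2))); split=> //.
  by apply: Rintegral_ge0 => s _; exact: powR_ge0.
move=> e e0.
have nuk' k : nu.-integrable setT (fun s : R => (s ^+ k)%:E) /\
    Rintegral nu setT (fun s : R => s ^+ k) = moment x k.
  by have [ik ek] := nuk k; split=> //; apply: complexI; rewrite momentC ek.
have p20 : 0 < p / 2 by rewrite divr_gt0.
have [L LP] := average_approx (spec_bound_gt0 x) (moment_match x) nu0 nuk'
  (@measurable_powR R (p / 2)) (continuous_powR_max p20) e0.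
exists (L * (max_size x + max_size x))%N => K LK V s Vu s0 AE.
rewrite (_ : (\sum_i s i `^ p) / _ = average (fun i => s i ^+ 2) (fun r : R => r `^ (p / 2))).
  exact: LP (rep_average_match LK Vu AE).
by rewrite /average; congr (_ / _); apply: eq_bigr => i _; rewrite sqr_powR_half.
Qed.

(** All polynomials are placed in one quotient, large enough for the required precision, where the
    Schatten inequality applies. *)
Lemma Lpnorm_fin_convex (p : R) m (c : 'I_m -> R) (xs : 'I_m -> P) y (A B : R) :
  1 <= p -> 0 < A -> 0 <= B -> (forall j, 0 <= c j) -> \sum_j c j <= A ->
  (forall g, coef y g = \sum_j (c j)%:C%C * coef (xs j) g) ->
  (forall j, Lpnorm_fin p (xs j) <= B) -> Lpnorm_fin p y <= A * B.
Proof.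
move=> p1 A0 B0 c0 cA ye xB.
have p0 : 0 < p by exact: lt_le_trans p1.
have pV0 : p^-1 != 0 by rewrite invr_eq0 gt_eqF.
have powK (r : R) : 0 <= r -> (r `^ p) `^ p^-1 = r.
  by move=> r0; rewrite -powRrM divff ?gt_eqF // powRr1.
have powKV (r : R) : 0 <= r -> (r `^ p^-1) `^ p = r.
  by move=> r0; rewrite -powRrM mulVf ?gt_eqF // powRr1.
have [r [r0 -> ry]] := Lpnorm_fin_approx y p0.
have /choice[rs rsP] : forall j, exists r : R, 0 <= r /\ r <= B `^ p /\
    forall e, 0 < e -> exists L,
    forall K, (L <= K)%N -> forall (V : 'M[C]_(quotient_order n K)) s,
    V \is unitarymx -> (forall i, 0 <= s i) ->
    (rep K (xs j))^t* *m rep K (xs j) = V^t* *m diag_mx (\row_i (s i ^+ 2)%:C%C) *m V ->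
    `|r - (\sum_i s i `^ p) / (quotient_order n K)%:R| <= e.
  move=> j; have [q [q0 qE qx]] := Lpnorm_fin_approx (xs j) p0; exists q; split=> //.
  split=> //; rewrite -(powKV q q0) ge0_ler_powR ?nnegrE ?powR_ge0 ?(ltW p0) //.
  by rewrite -qE.
suff rAB : r <= (A * B) `^ p.
  rewrite -[leRHS]powK ?mulr_ge0 ?(ltW A0) //.
  by rewrite ge0_ler_powR ?nnegrE ?powR_ge0 ?invr_ge0 ?(ltW p0).
(* The error e for y and the errors e for the xs j, multiplied by A^p, sum to e'. *)
apply/ler_addgt0Pr => e' e'0; pose e := e' / (1 + A `^ p).
have Ap0 : 0 <= A `^ p by exact: powR_ge0.
have e0 : 0 < e by rewrite divr_gt0 // ltr_wpDr.
have [L0 L0P] := ry e e0.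
have /choice[L LP] : forall j, exists L,
    forall K, (L <= K)%N -> forall (V : 'M[C]_(quotient_order n K)) s,
    V \is unitarymx -> (forall i, 0 <= s i) ->
    (rep K (xs j))^t* *m rep K (xs j) = V^t* *m diag_mx (\row_i (s i ^+ 2)%:C%C) *m V ->
    `|rs j - (\sum_i s i `^ p) / (quotient_order n K)%:R| <= e.
  by move=> j; have [_ [_ H]] := rsP j; exact: H.
pose K := maxn L0 (\max_j L j).
have [EZ [VZ [sZ [EZP VZu sZ0 ZE ZZ]]]] := svd (rep K y).
have /choice[F FP] : forall j, exists EVs : 'M[C]_(quotient_order n K) *
    'M[C]_(quotient_order n K) * ('I_(quotient_order n K) -> R),
    [/\ partial_isometry EVs.1.1 (fun i => EVs.2 i != 0), EVs.1.2 \is unitarymx,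
      forall i, 0 <= EVs.2 i,
      rep K (xs j) = EVs.1.1 *m diag_mx (\row_i (EVs.2 i)%:C%C) *m EVs.1.2 &
      (rep K (xs j))^t* *m rep K (xs j) =
        EVs.1.2^t* *m diag_mx (\row_i (EVs.2 i ^+ 2)%:C%C) *m EVs.1.2].
  by move=> j; have [E [V [s H]]] := svd (rep K (xs j)); exists (E, V, s).
have repE : rep K y = \sum_j (c j)%:C%C *: rep K (xs j).
  pose S := undup [seq reduce e.1 | e <- y ++ flatten [seq xs j | j <- enum 'I_m]].
  have uS : uniq S by exact: undup_uniq.
  have rS g : g \in S -> reduce g = g.
    by rewrite mem_undup => /mapP[e'' _ ->]; rewrite reduce_idem.
  rewrite (rep_coef K uS rS); last first.
    by move=> b bx; rewrite mem_undup; apply/mapP; exists b => //; rewrite mem_cat bx.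
  rewrite (eq_bigr (fun j => \sum_(g <- S)
    ((c j)%:C%C * coef (xs j) g) *: regular R K g)); last first.
    move=> j _; rewrite (rep_coef K uS rS) ?scaler_sumr.
      by apply: eq_bigr => g _; rewrite scalerA.
    move=> b bx; rewrite mem_undup; apply/mapP; exists b => //; rewrite mem_cat.
    apply/orP; right; apply/flattenP; exists (xs j) => //.
    by apply: map_f; rewrite mem_enum.
  rewrite exchange_big; apply: eq_bigr => g _ /=.
  by rewrite ye scaler_suml.
have conv : \sum_i sZ i `^ p <= A `^ p * \sum_j (c j / A) * \sum_i (F j).2 i `^ p.
  by apply: (@schatten_convex R _ m _ _ c A p _ _ _ (fun j => (F j).1.1)
    (fun j => (F j).1.2) (fun j => (F j).2) p1 A0 c0 cA repE EZP VZu sZ0 ZE) => j;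
    case: (FP j).
have := L0P K (leq_maxl _ _) VZ sZ VZu sZ0 ZZ.
set N := quotient_order n K in F FP conv *.
have N0 : 0 < N%:R :> R by rewrite ltr0n card_quotient_gt0.
rewrite ler_norml => /andP[_]; rewrite lerBlDr => rle.
have sj j : (\sum_i (F j).2 i `^ p) / N%:R <= B `^ p + e.
  have [_ Vu s0 _ AE] := FP j; have [_ [rB _]] := rsP j.
  have jK : (L j <= K)%N by rewrite leq_max leq_bigmax orbT.
  have := LP j K jK _ _ Vu s0 AE.
  rewrite distrC ler_norml => /andP[_]; rewrite lerBlDr => /le_trans; apply.
  by rewrite addrC lerD2r.
have convN : (\sum_i sZ i `^ p) / N%:R <= A `^ p * (B `^ p + e).
  apply: le_trans (ler_wpM2r _ conv) _; first by rewrite invr_ge0 ltW.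
  rewrite -mulrA ler_wpM2l // mulr_suml.
  apply: (@le_trans _ _ (\sum_j (c j / A) * (B `^ p + e))).
    apply: ler_sum => j _; rewrite -[leLHS]mulrA; apply: ler_wpM2l; last exact: sj.
    by rewrite divr_ge0 // ltW.
  rewrite -mulr_suml ler_piMl ?addr_ge0 ?powR_ge0 ?(ltW e0) //.
  by rewrite -mulr_suml ler_pdivrMr ?mul1r.
rewrite powRM ?(ltW A0) //; apply: (le_trans rle).
have -> : e' = e + A `^ p * e by rewrite /e; field; rewrite gt_eqF // ltr_wpDr.
by move: convN; rewrite mulrDr => ?; lra.
Qed.

End LpNorm.

(** * Rotations and multipliers *)

Section OperatorNorm.
Variables (n : nat) (R : realType).
Local Notation P := (fpoly n R).
Local Notation C := R[i].
Implicit Types (x y f : P) (g w : word n).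

Lemma tauE x K : (max_size x <= K)%N ->
  tau x = (quotient_order n K)%:R^-1 * \tr (rep K x).
Proof.
move=> xK; rewrite rep_trace; last exact: word_bound_le xK (@word_bound_max _ _ x).
by rewrite mulKf // pnatr_eq0 -lt0n card_quotient_gt0.
Qed.

(** For p = 2 the approximating trace is the first moment, which is exact in a large quotient.
    Convexity of [norm2] follows, and with it the case p = oo. *)
Lemma norm2_Lpnorm x : norm2 x = Lpnorm_fin 2 x.
Proof.
have [r [r0 -> rP]] := Lpnorm_fin_approx x (ltr0n R 2).
rewrite powR12_sqrt // /norm2; congr Num.sqrt.
have -> : complex.Re (tau (pmul (padj x) x)) = moment x 1.
  rewrite /moment; congr complex.Re.
  set y := pmul _ _; pose K := maxn (max_size y) (max_size (pexp y 1)).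
  rewrite (@tauE y K) ?leq_maxl // (@tauE (pexp y 1) K) ?leq_maxr //.
  by rewrite rep_exp /= mulmx1.
apply/eqP; rewrite eq_sym -subr_eq0 -normr_eq0 eq_le normr_ge0 andbT.
apply/ler_addgt0Pr => e e0; rewrite add0r.
have [L LP] := rP e e0; pose K := maxn L (1 * (max_size x + max_size x)).
have [E [V [s [_ Vu s0 _ AE]]]] := svd (rep K x).
have [_ _ ->//] := rep_average_match (leq_maxr L _ : _ <= K)%N Vu AE.
have := LP K (leq_maxl _ _) V s Vu s0 AE; rewrite /average.
by under eq_bigr => i _ do rewrite (powR_mulrn 2) //.
Qed.

Lemma norm2_ge0 x : 0 <= norm2 x.
Proof. exact: sqrtr_ge0. Qed.

Lemma norm2_mul1 w (u : C) f : `|u| = 1 -> norm2 (pmul [:: (w, u)] f) = norm2 f.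
Proof.
move=> u1; rewrite /norm2; congr (Num.sqrt (complex.Re _)).
set y1 := pmul _ _; set y2 := pmul _ _.
pose K := maxn (max_size y1) (max_size y2).
rewrite (@tauE y1 K) ?leq_maxl // (@tauE y2 K) ?leq_maxr //; congr (_ * \tr _).
rewrite /y1 /y2 !rep_mul !rep_adj rep_mul trmxC_mul -mulmxA; congr (_ *m _).
rewrite mulmxA -[RHS]mul1mx; congr (_ *m _).
rewrite rep1 (_ : (u *: _)^t* = u^* *: (regular R K w)^t*); last first.
  by apply/matrixP => i j; rewrite !mxE rmorphM.
rewrite -scalemxAl -scalemxAr scalerA.
rewrite -regular_winv regular_cat -regular_reduce reduce_Vmul regular_nil.
by rewrite mulrC -normCK u1 expr1n scale1r.
Qed.

Lemma norm2_convex m (c : 'I_m -> R) (xs : 'I_m -> P) y (A B : R) :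
  0 < A -> 0 <= B -> (forall j, 0 <= c j) -> \sum_j c j <= A ->
  (forall g, coef y g = \sum_j (c j)%:C%C * coef (xs j) g) ->
  (forall j, norm2 (xs j) <= B) -> norm2 y <= A * B.
Proof.
move=> A0 B0 c0 cA ye xB; rewrite norm2_Lpnorm.
apply: (Lpnorm_fin_convex _ A0 B0 c0 cA ye) => [|j]; first by rewrite ler1n.
by rewrite -norm2_Lpnorm.
Qed.

(** x is a positive combination of unitaries, the moduli of its coefficients being the weights. This
    bounds the set in [opnorm], making its [sup] a genuine supremum. *)
Lemma norm2_mul_le x f : norm2 (pmul x f) <= (l1_norm x + 1) * norm2 f.
Proof.
pose c (j : 'I_(size x)) := complex.Re `|(tnth (in_tuple x) j).2|.
have cC j : (c j)%:C%C = `|(tnth (in_tuple x) j).2|.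
  by rewrite RRe_real // normr_real.
(* The value 1 at z = 0 keeps every phase of modulus one. *)
pose ph (z : C) : C := if z == 0 then 1 else z / `|z|.
have ph1 z : `|ph z| = 1.
  rewrite /ph; case: eqP => [_|/eqP z0]; first exact: normr1.
  by rewrite normrM normfV normr_id divff // normr_eq0.
have phE z : `|z| * ph z = z.
  rewrite /ph; case: eqP => [->|/eqP z0]; first by rewrite normr0 mul0r.
  by rewrite mulrC divfK // normr_eq0.
apply: (@norm2_convex _ c (fun j => pmul [:: ((tnth (in_tuple x) j).1,
    ph (tnth (in_tuple x) j).2)] f)).
- by rewrite ltr_wpDl // l1_norm_ge0.
- exact: norm2_ge0.
- by move=> j; rewrite -ler0c cC.
- by rewrite /l1_norm [X in _ <= X + _]big_tnth lerDl.
- move=> g; rewrite coef_mul_sum; apply: eq_bigr => j _.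
  rewrite /pmul /= !cats0 !coef_sumE !big_map mulr_sumr; apply: eq_bigr => b _ /=.
  by rewrite cC [RHS]mulrCA; congr (_ * _); rewrite mulrA phE.
- by move=> j; rewrite norm2_mul1.
Qed.

Lemma opnorm_ub x f : norm2 f <= 1 -> norm2 (pmul x f) <= opnorm x.
Proof.
move=> f1; apply: ub_le_sup; last by exists f.
exists (l1_norm x + 1) => _ [h [h1 ->]].
apply: le_trans (norm2_mul_le x h) _.
by rewrite ler_piMr // addr_ge0 // l1_norm_ge0.
Qed.

Lemma norm2_nil : norm2 ([::] : P) = 0.
Proof. by rewrite /norm2 /pmul /= /tau coef_sumE big_nil sqrtr0. Qed.

Lemma opnorm_le x B : (forall f, norm2 f <= 1 -> norm2 (pmul x f) <= B) -> opnorm x <= B.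
Proof.
move=> xB; apply: ge_sup; last by move=> _ [f [f1 ->]]; exact: xB.
by exists (norm2 (pmul x [::])), [::]; rewrite norm2_nil.
Qed.

Lemma Lpnorm_ge0 (p : \bar R) x : (1%:E <= p)%E -> 0 <= Lpnorm p x.
Proof.
case: p => [p| |] //= p1.
  have p0 : 0 < p by rewrite (lt_le_trans ltr01) // -lee_fin.
  by have [r [_ -> _]] := Lpnorm_fin_approx x p0; exact: powR_ge0.
apply: le_trans (norm2_ge0 (pmul x [::])) _.
by apply: opnorm_ub; rewrite norm2_nil.
Qed.

End OperatorNorm.

(** * The circle action and its averages *)

Section Rotation.
Variables (n : nat) (R : realType).
Local Notation P := (fpoly n R).
Local Notation C := R[i].
Implicit Types (x y f : P) (g w : word n) (u v : C).

(** The conjugate stands for the inverse of u, so the product over a word is invariant under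
    reduction when |u| = 1. *)
Definition letter_char u (a : letter n) : C := if a.2 then u else u^*.

Definition word_char u w : C := \prod_(a <- w) letter_char u a.

Lemma word_char_cat u w1 w2 : word_char u (w1 ++ w2) = word_char u w1 * word_char u w2.
Proof. exact: big_cat. Qed.

Lemma word_char_conj u w : word_char u^* w = (word_char u w)^*.
Proof.
rewrite /word_char rmorph_prod; apply: eq_bigr => a _.
by rewrite /letter_char; case: a.2.
Qed.

Lemma word_char_reduce u w : `|u| = 1 -> word_char u (reduce w) = word_char u w.
Proof.
move=> u1; have uJ : u * u^* = 1 by rewrite -normCK u1 expr1n.
rewrite reduceE; elim: w => //= a w IH.
rewrite [RHS]/word_char big_cons -/(word_char u w) -IH.
case: (foldr _ _ w) => [|b w1] /=.
  by rewrite /word_char big_seq1 big_nil mulr1.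
case: ifP => [/andP[_ /eqP b2]|_]; last by rewrite /word_char big_cons.
rewrite [in RHS]/word_char big_cons -/(word_char u w1) mulrA.
rewrite (_ : letter_char u a * letter_char u b = 1) ?mul1r // /letter_char b2.
by case: a.2 => //=; rewrite mulrC.
Qed.

Lemma word_char_winv u w : word_char u (winv w) = (word_char u w)^*.
Proof.
rewrite -word_char_conj /word_char /winv (perm_big _ (permEl (perm_rev _))) big_map.
apply: eq_bigr => a _; rewrite /letter_char /=.
by case: a.2 => //=; rewrite conjCK.
Qed.

Lemma word_char_norm u w : `|u| = 1 -> `|word_char u w| = 1.
Proof.
move=> u1; rewrite /word_char normr_prod big1 // => a _.
by rewrite /letter_char; case: a.2; rewrite ?norm_conjC.
Qed.

Lemma word_char_pos u w : all (fun a : letter n => a.2) w -> word_char u w = u ^+ size w.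
Proof.
elim: w => [_|a w IH /= /andP[a2 /IH wE]]; first by rewrite /word_char big_nil.
by rewrite /word_char big_cons -/(word_char u w) wE exprS /letter_char a2.
Qed.

(* The trace preserving automorphism lambda_{g_i} |-> u lambda_{g_i}, followed by
   multiplication by v. *)
Definition rotate u v x : P := [seq (e.1, v * word_char u e.1 * e.2) | e <- x].

Lemma coef_rotate u v x g : `|u| = 1 -> coef (rotate u v x) g = v * word_char u g * coef x g.
Proof.
move=> u1; rewrite !coef_sumE big_map mulr_sumr; apply: eq_bigr => e _ /=.
case: eqP => [eg|_]; last by rewrite !mul0r mulr0.
by rewrite !mul1r -(word_char_reduce _ u1) eg word_char_reduce.
Qed.

Lemma pmul_rotate u v v' x y : `|u| = 1 ->
  pmul (rotate u v x) (rotate u v' y) = rotate u (v * v') (pmul x y).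
Proof.
move=> u1; rewrite /pmul /rotate allpairs_mapl allpairs_mapr map_allpairs.
apply: eq_allpairs => a b /=; congr (_, _).
by rewrite /wmul word_char_reduce // word_char_cat; ring.
Qed.

Lemma padj_rotate u v x : padj (rotate u v x) = rotate u v^* (padj x).
Proof.
rewrite /padj /rotate -!map_comp; apply: eq_map => e /=; congr (_, _).
by rewrite conjcE !rmorphM /= word_char_winv.
Qed.

Lemma tau_rotate u v x : `|u| = 1 -> tau (rotate u v x) = v * tau x.
Proof. by move=> u1; rewrite /tau coef_rotate // /word_char big_nil mulr1. Qed.

Lemma pexp_rotate u x k : `|u| = 1 -> pexp (rotate u 1 x) k = rotate u 1 (pexp x k).
Proof.
move=> u1; elim: k => [|k IH] /=.
  by rewrite /rotate /= /word_char big_nil !mulr1.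
by rewrite IH pmul_rotate // mulr1.
Qed.

Lemma sqr_rotate u v x : `|u| = 1 -> `|v| = 1 ->
  pmul (padj (rotate u v x)) (rotate u v x) = rotate u 1 (pmul (padj x) x).
Proof.
move=> u1 v1; rewrite padj_rotate pmul_rotate //; congr rotate.
by rewrite mulrC -normCK v1 expr1n.
Qed.

Lemma norm2_rotate u v x : `|u| = 1 -> `|v| = 1 -> norm2 (rotate u v x) = norm2 x.
Proof. by move=> u1 v1; rewrite /norm2 sqr_rotate // tau_rotate // mul1r. Qed.

Lemma rotateK u x : `|u| = 1 -> rotate u 1 (rotate u^* 1 x) = x.
Proof.
move=> u1; rewrite /rotate -map_comp -[RHS]map_id; apply: eq_map => -[w c] /=.
by rewrite word_char_conj !mul1r mulrA -normCK word_char_norm // expr1n mul1r.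
Qed.

(** A rotation preserves all moments of x^* x, so [xget] chooses from the same set; for p = oo the
    vector f is first rotated back. *)
Lemma Lpnorm_rotate (p : \bar R) u v x : `|u| = 1 -> `|v| = 1 ->
  Lpnorm p (rotate u v x) <= Lpnorm p x.
Proof.
move=> u1 v1; case: p => [p| |] //=.
  rewrite /Lpnorm_fin sqr_rotate // le_eqVlt; apply/orP; left; apply/eqP; congr xget.
  have tE k : tau (pexp (rotate u 1 (pmul (padj x) x)) k) =
      tau (pexp (pmul (padj x) x) k).
    by rewrite pexp_rotate // tau_rotate // mul1r.
  have dE mu : is_distribution (rotate u 1 (pmul (padj x) x)) mu =
      is_distribution (pmul (padj x) x) mu.
    rewrite /is_distribution; apply/propext.
    by split=> -[mu0 muk]; split=> // k; have [ik ek] := muk k; rewrite ek tE.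
  by apply/seteqP; split=> r [mu [h e]]; exists mu; rewrite ?dE // in h *.
apply: opnorm_le => f f1; rewrite -[f in pmul _ f](rotateK f u1) pmul_rotate // mulr1.
by rewrite norm2_rotate // opnorm_ub // norm2_rotate ?norm_conjC ?normr1.
Qed.

(* Averaging rotations against a positive measure on the circle gives a multiplier
   whose norm on every L_p is at most the mass of the measure. *)
Lemma multiplier_le (p : \bar R) x y (phi : nat -> R) D (k : word n -> nat) :
  (1%:E <= p)%E -> circle_moments D phi -> 0 < phi 0%N ->
  (forall g, coef x g != 0 -> (k g <= D)%N) ->
  (forall u, `|u| = 1 -> exists u' v', [/\ `|u'| = 1, `|v'| = 1 &
     forall g, coef x g != 0 -> v' * word_char u' g = u ^+ k g]) ->
  (forall g, coef y g = (phi (k g))%:C%C * coef x g) ->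
  Lpnorm p y <= phi 0%N * Lpnorm p x.
Proof.
move=> p1 [N [c [u [c0 u1 cu]]]] phi0 kD tw ye.
have /choice[t tP] : forall j, exists t : C * C, [/\ `|t.1| = 1, `|t.2| = 1 &
     forall g, coef x g != 0 -> t.2 * word_char t.1 g = u j ^+ k g].
  by move=> j; have [u' [v' H]] := tw _ (u1 j); exists (u', v').
pose xs j := rotate (t j).1 (t j).2 x.
have cphi : \sum_j c j <= phi 0%N.
  rewrite -lecR cu // rmorph_sum le_eqVlt; apply/orP; left; apply/eqP.
  by apply: eq_bigr => j _; rewrite expr0 mulr1.
have xB j : Lpnorm p (xs j) <= Lpnorm p x.
  by have [? ? _] := tP j; exact: Lpnorm_rotate.
have yxs g : coef y g = \sum_j (c j)%:C%C * coef (xs j) g.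
  rewrite ye; have [x0|x0] := eqVneq (coef x g) 0.
    rewrite x0 mulr0 big1 // => j _; have [? _ _] := tP j.
    by rewrite coef_rotate // x0 !mulr0.
  rewrite cu ?kD // mulr_suml; apply: eq_bigr => j _; have [? _ h] := tP j.
  by rewrite coef_rotate // h // mulrA.
have B0 := Lpnorm_ge0 x p1.
case: p p1 xB B0 => [p| |] //= p1 xB B0.
  by apply: (Lpnorm_fin_convex _ phi0 B0 c0 cphi yxs xB); rewrite -lee_fin.
apply: opnorm_le => f f1.
apply: (@norm2_convex _ _ _ c (fun j => pmul (xs j) f)) => // [g|j].
  rewrite coef_mul; under eq_bigr => b _ do rewrite yxs mulr_suml.
  rewrite exchange_big; apply: eq_bigr => j _ /=.
  by rewrite coef_mul mulr_sumr; apply: eq_bigr => b _; rewrite mulrA.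
by apply: le_trans (xB j); exact: opnorm_ub.
Qed.

Lemma coef_Pt t x g : coef (Pt t x) g = (expR (- (t * (wlen g)%:R)))%:C%C * coef x g.
Proof.
rewrite !coef_sumE big_map mulr_sumr; apply: eq_bigr => e _ /=.
case: eqP => [eg|_]; last by rewrite !mul0r mulr0.
by rewrite !mul1r /wlen eg.
Qed.

Lemma coef_Lgen x g : coef (Lgen x) g = ((wlen g)%:R : R)%:C%C * coef x g.
Proof.
rewrite !coef_sumE big_map mulr_sumr; apply: eq_bigr => e _ /=.
case: eqP => [eg|_]; last by rewrite !mul0r mulr0.
by rewrite !mul1r /wlen eg.
Qed.

Lemma word_char_holomorphic x u g : holomorphic x -> `|u| = 1 -> coef x g != 0 ->
  word_char u g = u ^+ wlen g.
Proof.
by move=> xh u1 /xh gp; rewrite -(word_char_reduce _ u1) word_char_pos.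
Qed.

(** The shift by d is free: u^(|g| - d) is the rotation by u times the unimodular scalar u^(-d). *)
Lemma multiplier_ge_le (p : \bar R) x y (phi : nat -> R) d :
  (1%:E <= p)%E -> holomorphic x -> in_Pge d x ->
  (forall k, 0 <= phi k) -> (forall k, phi k.+1 <= phi k) ->
  (forall k, phi k.+1 *+ 2 <= phi k + phi k.+2) -> 0 < phi 0%N ->
  (forall g, coef x g != 0 -> coef y g = (phi (wlen g - d)%N)%:C%C * coef x g) ->
  (forall g, coef x g = 0 -> coef y g = 0) ->
  Lpnorm p y <= phi 0%N * Lpnorm p x.
Proof.
move=> p1 xh xd phi_ge0 phi_dec phi_conv phi0 yx y0.
apply: (@multiplier_le p x y phi (max_size x) (fun g => (wlen g - d)%N)) => //.
- exact: circle_moments_convex.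
- by move=> g /coef_neq0_size; apply: leq_trans; exact: leq_subr.
- move=> u u1; exists u, (u^* ^+ d); split=> // [|g gx].
    by rewrite normrX norm_conjC u1 expr1n.
  rewrite (word_char_holomorphic xh) // -{1}(subnKC (xd g gx)) exprD mulrA.
  by rewrite -exprMn [_^* * _]mulrC -normCK u1 !expr1n mul1r.
- by move=> g; have [x0|/yx//] := eqVneq (coef x g) 0; rewrite y0 // x0 mulr0.
Qed.

(** Here u^(d - |g|) is the rotation by the conjugate of u times the scalar u^d. *)
Lemma multiplier_le_le (p : \bar R) x y (phi : nat -> R) d :
  (1%:E <= p)%E -> holomorphic x -> in_Ple d x ->
  (forall k, 0 <= phi k) -> (forall k, phi k.+1 <= phi k) ->
  (forall k, phi k.+1 *+ 2 <= phi k + phi k.+2) -> 0 < phi 0%N ->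
  (forall g, coef x g != 0 -> coef y g = (phi (d - wlen g)%N)%:C%C * coef x g) ->
  (forall g, coef x g = 0 -> coef y g = 0) ->
  Lpnorm p y <= phi 0%N * Lpnorm p x.
Proof.
move=> p1 xh xd phi_ge0 phi_dec phi_conv phi0 yx y0.
apply: (@multiplier_le p x y phi d (fun g => (d - wlen g)%N)) => //.
- exact: circle_moments_convex.
- by move=> g _; exact: leq_subr.
- move=> u u1; exists u^*, (u ^+ d); split=> [||g gx].
  + by rewrite norm_conjC.
  + by rewrite normrX u1 expr1n.
  rewrite (word_char_holomorphic xh) ?norm_conjC // -{1}(subnK (xd g gx)) exprD -mulrA.
  by rewrite -exprMn -normCK u1 !expr1n mulr1.
- by move=> g; have [x0|/yx//] := eqVneq (coef x g) 0; rewrite y0 // x0 mulr0.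
Qed.

End Rotation.

Theorem theorem1p1 (R : realType) (n d : nat) (p : \bar R) (x : fpoly n R) :
  (1 <= n)%N -> (1 <= d)%N -> (1%:E <= p)%E -> holomorphic x ->
  (in_Pge d x ->
     (forall t : R, 0 <= t -> Lpnorm p (Pt t x) <= expR (- (t * d%:R)) * Lpnorm p x)
     /\ d%:R * Lpnorm p x <= Lpnorm p (Lgen x))
  /\
  (in_Ple d x ->
     Lpnorm p (Lgen x) <= d%:R * Lpnorm p x
     /\ (forall t : R, 0 <= t -> expR (- (t * d%:R)) * Lpnorm p x <= Lpnorm p (Pt t x))).
Proof.
move=> _ d1 p1 xh; have d0 : 0 < d%:R :> R by rewrite ltr0n.
have geo_dec (a t : R) k : 0 < a -> 0 <= t -> a * expR (- (t * k.+1%:R)) <= a * expR (- (t * k%:R)).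
  by move=> a0 t0; rewrite ler_pM2l // ler_expR lerN2 ler_wpM2l // ler_nat.
have geo_conv (a t : R) k : 0 < a -> 0 <= t ->
    a * expR (- (t * k.+1%:R)) *+ 2 <=
    a * expR (- (t * k%:R)) + a * expR (- (t * k.+2%:R)).
  move=> a0 t0; have E j : expR (- (t * j.+1%:R)) = expR (- (t * j%:R)) * expR (- t).
    by rewrite -expRD; congr expR; rewrite -natr1; ring.
  rewrite !E; set z := expR (- (t * _)); set r := expR (- t).
  have z0 : 0 < z by exact: expR_gt0.
  rewrite -subr_ge0 (_ : _ - _ = a * (z * (r - 1) ^+ 2)); last by ring.
  by rewrite mulr_ge0 ?(ltW a0) // mulr_ge0 ?(ltW z0) // sqr_ge0.
split=> xd; split.
- move=> t t0; pose a := expR (- (t * d%:R)).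
  have a0 : 0 < a by exact: expR_gt0.
  have := @multiplier_ge_le n R p x (Pt t x) (fun k => a * expR (- (t * k%:R))) d p1 xh xd.
  rewrite mulr0 oppr0 expR0 mulr1; apply=> //.
  + by move=> k; rewrite mulr_ge0 ?expR_ge0 // ltW.
  + by move=> k; exact: geo_dec.
  + by move=> k; exact: geo_conv.
  + move=> g gx; rewrite coef_Pt; congr (_%:C%C * _).
    by rewrite /a -expRD natrB ?xd //; congr expR; ring.
  + by move=> g x0; rewrite coef_Pt x0 mulr0.
(* The symbol 1/(d + k) recovers x from L x; as d >= 1, L kills no coefficient of x. *)
- pose y := Lgen x.
  have yx g : coef y g != 0 -> coef x g != 0.
    by apply: contraNneq => x0; rewrite coef_Lgen x0 mulr0.
  have pos k : 0 < (d + k)%:R :> R by rewrite ltr0n addn_gt0 d1.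
  have := @multiplier_ge_le n R p y x (fun k => (d + k)%:R^-1) d p1 _ _.
  rewrite addn0 => H; rewrite -ler_pdivlMl //; apply: H => //.
  + by move=> g /yx; exact: xh.
  + by move=> g /yx; exact: xd.
  + by move=> k; rewrite lef_pV2 ?posrE // ler_nat addnS.
  + move=> k; rewrite !addnS -!natr1; set z := (d + k)%:R.
    have z0 : 0 < z by exact: pos.
    rewrite -subr_ge0 (_ : _ - _ = 2 / (z * (z + 1) * (z + 1 + 1))).
      by rewrite divr_ge0 // !mulr_ge0 ?addr_ge0 // ltW.
    by field; rewrite -?andbA; repeat (apply/andP; split); apply: lt0r_neq0; lra.
  + by rewrite invr_gt0.
  + move=> g gy; rewrite coef_Lgen subnKC ?xd ?yx // mulrA -rmorphM mulVf ?mul1r //.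
    rewrite pnatr_eq0 -lt0n; apply: leq_trans d1 _; exact: xd (yx _ gy).
  + move=> g; rewrite coef_Lgen => /eqP; rewrite mulf_eq0 => /orP[|/eqP//].
    move=> w0; apply/eqP; apply: contraTT w0 => /xd dg.
    rewrite -[0]/(0%:C%C) (inj_eq (@complexI R)) pnatr_eq0 -lt0n.
    exact: leq_trans d1 dg.
(* Truncated subtraction makes this symbol (d - k)_+ , convex on all naturals including the corner
   at k = d. *)
- have := @multiplier_le_le n R p x (Lgen x) (fun k => (d - k)%:R) d p1 xh xd.
  rewrite subn0; apply=> //.
  + by move=> k; rewrite ler_nat; lia.
  + by move=> k; rewrite -natrD -mulrnA ler_nat; lia.
  + by move=> g gx; rewrite coef_Lgen subKn // xd.
  + by move=> g x0; rewrite coef_Lgen x0 mulr0.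
(* The inverse of P_t has symbol e^(t|g|) = e^(td) e^(-tk) with k = d - |g|, decreasing in k. *)
- move=> t t0; pose a := expR (t * d%:R).
  have a0 : 0 < a by exact: expR_gt0.
  have yx g : coef (Pt t x) g != 0 -> coef x g != 0.
    by apply: contraNneq => x0; rewrite coef_Pt x0 mulr0.
  have := @multiplier_le_le n R p (Pt t x) x (fun k => a * expR (- (t * k%:R))) d p1 _ _.
  rewrite mulr0 oppr0 expR0 mulr1 => H.
  rewrite expRN -ler_pdivlMl ?invr_gt0 ?expR_gt0 // invrK; apply: H => //.
  + by move=> g /yx; exact: xh.
  + by move=> g /yx; exact: xd.
  + by move=> k; rewrite mulr_ge0 ?expR_ge0 // ltW.
  + by move=> k; exact: geo_dec.
  + by move=> k; exact: geo_conv.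
  + move=> g /yx gx; rewrite coef_Pt mulrA -rmorphM /a -!expRD natrB ?xd //.
    have -> : t * d%:R - t * (d%:R - (wlen g)%:R) - t * (wlen g)%:R = 0 by ring.
    by rewrite expR0 mul1r.
  + move=> g; rewrite coef_Pt => /eqP; rewrite mulf_eq0 => /orP[|/eqP//].
    by rewrite -[0]/(0%:C%C) (inj_eq (@complexI R)) gt_eqF // expR_gt0.
Qed.
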